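(* Let $\Delta$ be a finite simplicial complex with $\operatorname{depth}\Delta = d-1$, and let $r$ be a positive integer with $r<d/2$. Suppose $\Delta$ is shifted with respect to a vertex $a$. Then $\Delta$ is strictly $r$-EKR; that is: (i) for every intersecting family $\mathcal{A}$ of $r$-element faces of $\Delta$ there is a vertex $v$ of $\Delta$ with $|\mathcal{A}|\le f_{r-1}(\operatorname{link}_\Delta v)$, and (ii) every intersecting family of $r$-element faces of $\Delta$ of maximum possible cardinality has a common intersection (i.e. some vertex lies in all of its members).
   Context: A simplicial complex $\Delta$ is a nonempty finite family of sets closed under taking subsets; its members are faces, and the dimension of a face $A$ is $|A|-1$. For a nonnegative integer $k$, $f_k(\Delta)$ denotes the number of $k$-element faces of $\Delta$. The link of a face $A$ is $\operatorname{link}_\Delta A=\{B\in\Delta: A\cap B=\emptyset,\ A\cup B\in\Delta\}$. Fix a field $\mathbb{F}$ (depth is taken over $\mathbb{F}$). $\Delta$ is Cohen-Macaulay if $\tilde H_i(\operatorname{link}_\Delta A;\mathbb{F})=0$ for every face $A\in\Delta$ (including $A=\emptyset$) and every $i<\dim\operatorname{link}_\Delta A$, where $\tilde H_i$ is reduced simplicial homology. The $k$-dimensional skeleton of $\Delta$ is the subcomplex of faces of dimension at most $k$. The depth of $\Delta$ is the largest $k$ such that the $k$-dimensional skeleton of $\Delta$ is Cohen-Macaulay. $\Delta$ is shifted with respect to a vertex $a$ (a near-cone with apex $a$) if whenever $B\in\Delta$ and $w\in B$, also $(B\setminus\{w\})\cup\{a\}\in\Delta$. A family is intersecting if any two of its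 members have nonempty intersection. *)

(* Defs.v *)
From mathcomp Require Import all_boot all_order all_algebra.
Set Implicit Arguments. Unset Strict Implicit. Unset Printing Implicit Defensive.
Import GRing.Theory Num.Theory.

Definition simplicial_complex (V : finType) (D : {set {set V}}) : Prop :=
  D != set0 /\ forall A B : {set V}, A \in D -> B \subset A -> B \in D.

Definition fnum (V : finType) (D : {set {set V}}) (k : nat) : nat :=
  #|[set A in D | #|A| == k]|.

Definition link (V : finType) (D : {set {set V}}) (A : {set V}) : {set {set V}} :=
  [set B in D | [disjoint A & B] && (A :|: B \in D)].

(* the maximal size of a face; dim D = maxsize D - 1 *)
Definition maxsize (V : finType) (D : {set {set V}}) : nat :=
  \max_(A in D) #|A|.

(* faces of size <= m, i.e. the (m-1)-dimensional skeleton *)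
Definition skeleton (V : finType) (D : {set {set V}}) (m : nat) : {set {set V}} :=
  [set A in D | #|A| <= m].

(* ---- Reduced simplicial homology over a field F ----
   Chains are row vectors indexed by all subsets of V (via enum_val);
   the chain group C_k (faces of size k, i.e. dimension k-1) is the span of the
   coordinate vectors of faces of D of size k.  Vertices are ordered by
   enum_rank.  The boundary matrix bd D k (acting on row vectors, x *m bd)
   sends a face A of size k to sum over its facets B = A \ {v} of
   (-1)^(#{w in B | w < v}) B.  Size-0 face (the empty face) is included, so
   this is the augmented (reduced) chain complex. *)
Section Homology.
Variables (F : fieldType) (V : finType).
Local Notation n := #|{set V}|.

Definition chains (D : {set {set V}}) (k : nat) : 'M[F]_n :=
  diag_mx (\row_(i < n) (if (enum_val i \in D) && (#|enum_val i| == k)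
                          then 1%R else 0%R) : 'rV[F]_n).

Definition bd_sign (A B : {set V}) : F :=
  ((-1) ^+ #|[set w in B | [exists u in A :\: B,
                              (enum_rank w < enum_rank u)%N]]|)%R.

Definition bd (D : {set {set V}}) (k : nat) : 'M[F]_n :=
  \matrix_(i < n, j < n)
    (let A := enum_val i in let B := enum_val j in
     if [&& A \in D, #|A| == k, B \subset A & #|B|.+1 == #|A|]
     then bd_sign A B else 0%R).

(* reduced homology H~_{k-1}(D; F) vanishes: every (k-1)-cycle is a boundary *)
Definition rhom_vanishes (D : {set {set V}}) (k : nat) : bool :=
  (kermx (bd D k) :&: chains D k <= bd D k.+1)%MS.

(* Cohen-Macaulay over F: for every face A (including the empty face) and
   every i < dim link A, H~_i(link A) = 0; with k = i+1 this is
   k < maxsize (link A). *)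
Definition cohen_macaulay (D : {set {set V}}) : bool :=
  [forall A in D, forall k : 'I_(maxsize (link D A)),
    rhom_vanishes (link D A) k].

(* depth D + 1 = the largest m <= dim D + 1 such that the (m-1)-skeleton
   is Cohen-Macaulay (m = 0 always qualifies). *)
Definition depth_size (D : {set {set V}}) : nat :=
  \max_(m < (maxsize D).+1 | cohen_macaulay (skeleton D m)) (m : nat).
Definition depth (D : {set {set V}}) : int := (depth_size D)%:Z - 1.
End Homology.

Definition shifted_wrt (V : finType) (D : {set {set V}}) (a : V) : Prop :=
  forall B w, B \in D -> w \in B -> (B :\ w) :|: [set a] \in D.

Definition intersecting_faces (V : finType) (D : {set {set V}}) (r : nat)
    (FA : {set {set V}}) : Prop :=
  FA \subset D /\ (forall A, A \in FA -> #|A| = r) /\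
  (forall A B, A \in FA -> B \in FA -> A :&: B != set0).

(* Main.v *)
From HB Require Import structures.
Require Import Defs.
From mathcomp Require Import all_boot all_order all_algebra.
From mathcomp Require Import ring zify.

(* Since D is shifted with respect to a, its faces of size below d are those of the cone over the
   complex L = link a, where L has depth at least d - 2. Hence an intersecting family splits into
   an intersecting X in level r of L and a family Y in level r - 1 of L with X and Y
   cross-intersecting, and the bound reads #|X| + #|Y| <= f_(r-1)(L).

   This is proved by exterior algebraic shifting over an infinite extension K of F. For a suitable
   sequence of functionals on the vertices, the leading words of the chains supported on a family
   form a family of words of the same cardinality; it is closed under shifting, and disjoint words
   would give a nonzero wedge product, so cross-intersection is preserved. The Cohen-Macaulay
   hypothesis enters through the exactness of iterated boundary maps on the chains of L (proved by
   resolving them by the chains of the stars of faces, which are cones): leading words of L may be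
   filled with ones on an initial segment as long as the size does not exceed the depth. Then
   complementing a word of X up to its last crossing of the diagonal injects the words of X into
   the words of level r - 1 of L that are not words of Y.

   For uniqueness, the bound is strict when X is nonempty and its shadow lies in Y. Every maximum
   family is brought to that situation by the shifts A -> A - v + a, and the same method applied
   to two cross-intersecting families shows that a family that is shifted onto a star is a star. *)

(** Filling a prefix with ones passes through faces of up to [p + q] vertices, for families of sizes
    [p] and [q]. The link of [a] has room for [d - 1], and [r + (r - 1)] must fit. Strictness costs
    one more vertex: [r + (r - 1) < d - 1] is exactly [2r < d]. Uniqueness deletes a further vertex,
    leaving [d - 2], but compares two families of size [r - 1], which gives the same inequality.

    The definition of Cohen-Macaulay bounds the homology of each link by the dimension of that link,
    while the resolution by stars needs a bound depending only on the size of the face. Purity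
    closes this gap: links lose exactly one dimension per vertex.

    No generic matrix is constructed. A bounded integer measures how early the leading words come,
    and a one-parameter perturbation raises it as long as some family of words is not shifted. This
    asks only for infinitely many scalars; vanishing of homology is a condition on ranks and
    survives the extension. *)

Set Implicit Arguments. Unset Strict Implicit. Unset Printing Implicit Defensive.
Import GRing.Theory.

(** * Exterior algebra on the vertices *)

Section Chains.
Local Open Scope ring_scope.
Variables (K : fieldType) (V : finType).
Implicit Types (A B C : {set V}) (u v w : V).

Local Notation chain := {ffun {set V} -> K^o}.
Implicit Types x y z : chain.

(** For disjoint [A] and [B], the sign of sorting [A] followed by [B] is [(-1) ^+ ninv A B]. One
    count serves boundary, multiplication and wedge, so sign identities become parities of additive
    counts. *)
Definition ninv A B : nat :=
  \sum_(a in A) \sum_(b in B) (enum_rank b < enum_rank a)%N.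

Lemma eq_sign a b : odd a = odd b -> (-1) ^+ a = (-1) ^+ b :> K.
Proof. by move=> e; rewrite -signr_odd e signr_odd. Qed.

Lemma opp_sign a b : odd a = ~~ odd b -> (-1) ^+ a = - (-1) ^+ b :> K.
Proof. by move=> e; rewrite -signr_odd e signrN signr_odd. Qed.

Lemma ninvUl v A B : v \notin A ->
  ninv (v |: A) B = (ninv [set v] B + ninv A B)%N.
Proof. by move=> vA; rewrite /ninv big_setU1 //= big_set1. Qed.

Lemma ninvUr v A B : v \notin B ->
  ninv A (v |: B) = (ninv A [set v] + ninv A B)%N.
Proof.
move=> vB; rewrite /ninv -big_split /=; apply: eq_bigr => a _.
by rewrite big_setU1 //= big_set1.
Qed.

Lemma ninv11 v w : v != w -> (ninv [set v] [set w] + ninv [set w] [set v] = 1)%N.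
Proof.
move=> vw; rewrite /ninv !big_set1.
case: ltngtP => // /val_inj /enum_rank_inj e; by rewrite e eqxx in vw.
Qed.

Lemma odd_ninv11 v w : v != w ->
  odd (ninv [set v] [set w]) = ~~ odd (ninv [set w] [set v]).
Proof.
by move=> /ninv11/(congr1 odd); rewrite oddD; do 2!case: (odd (ninv _ _)).
Qed.

Lemma ninv_sym v A : v \notin A -> (ninv [set v] A + ninv A [set v] = #|A|)%N.
Proof.
move=> vA; rewrite -sum1_card /ninv big_set1 -big_split /=.
apply: eq_bigr => w wA; have vw : v != w by apply: contraNneq vA => ->.
by rewrite big_set1 -[RHS](ninv11 vw) /ninv !big_set1.
Qed.

(* The sign counts the vertices of B smaller than v, as in bd_sign. *)
Definition contr v x : chain :=
  [ffun B : {set V} => if v \in B then 0 else (-1) ^+ ninv [set v] B * x (v |: B)].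
Definition vmul v x : chain :=
  [ffun B : {set V} => if v \in B then (-1) ^+ ninv [set v] (B :\ v) * x (B :\ v) else 0].

Lemma contr_is_linear v : linear (contr v).
Proof.
move=> a x y; apply/ffunP=> B; rewrite !ffunE; case: ifP => _.
  by rewrite scaler0 addr0.
by rewrite mulrDr scalerAr.
Qed.
HB.instance Definition _ v := GRing.isLinear.Build K chain chain _ (contr v) (contr_is_linear v).

Lemma vmul_is_linear v : linear (vmul v).
Proof.
move=> a x y; apply/ffunP=> B; rewrite !ffunE; case: ifP => _.
  by rewrite mulrDr scalerAr.
by rewrite scaler0 addr0.
Qed.
HB.instance Definition _ v := GRing.isLinear.Build K chain chain _ (vmul v) (vmul_is_linear v).

Lemma contr_sq v x : contr v (contr v x) = 0.
Proof. by apply/ffunP=> B; rewrite !ffunE setU11 mulr0 if_same. Qed.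

Lemma contrC v w x : contr v (contr w x) = - contr w (contr v x).
Proof.
have [->|vw] := eqVneq v w; first by rewrite contr_sq oppr0.
apply/ffunP=> B; rewrite !ffunE !inE (eq_sym w) (negPf vw) /=.
case: (boolP (v \in B)) => vB; case: (boolP (w \in B)) => wB /=; rewrite ?mulr0 ?oppr0 //.
rewrite setUCA !mulrA -!exprD !ninvUr ?inE //.
rewrite -mulNr; congr (_ * _).
apply: opp_sign; rewrite !oddD (odd_ninv11 vw).
by do 3!case: (odd _).
Qed.

Lemma contr_vmul v w x :
  contr v (vmul w x) = (if v == w then x else 0) - vmul w (contr v x).
Proof.
apply/ffunP=> B; rewrite !ffunE; have [->|vw] := eqVneq v w.
  rewrite !inE eqxx; case: (boolP (w \in B)) => wB /=; rewrite ?setD11.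
    by rewrite setD1K // mulrA -exprD addnn -signr_odd odd_double expr0 mul1r subrr.
  by rewrite setU1K // mulrA -exprD addnn -signr_odd odd_double expr0 mul1r subr0.
rewrite !inE (negPf vw) (eq_sym w) (negPf vw) /= ffunE.
case: (boolP (v \in B)) => vB; case: (boolP (w \in B)) => wB //=; rewrite ?mulr0 ?oppr0 ?addr0 //.
have -> : (v |: B) :\ w = v |: (B :\ w).
  by apply/setP=> u; rewrite !inE; case: (eqVneq u v) => // ->; rewrite vw.
rewrite -[X in ninv _ X](setD1K wB) !ninvUr ?inE ?eqxx ?(negPf vB) ?andbF //.
rewrite !mulrA -!exprD sub0r -mulNr; congr (_ * _).
apply: opp_sign; rewrite !oddD (odd_ninv11 vw).
by do 3!case: (odd _).
Qed.

Definition wedge x y : chain :=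
  [ffun C : {set V} => \sum_(A : {set V} | A \subset C) (-1) ^+ ninv A (C :\: A) * (x A * y (C :\: A))].

Definition homog k x := forall A, x A != 0 -> #|A| = k.

Lemma sum_subsetU1 v C (F : {set V} -> K) : v \notin C ->
  \sum_(A : {set V} | (A \subset v |: C) && (v \in A)) F A
    = \sum_(A : {set V} | A \subset C) F (v |: A).
Proof.
move=> vC; rewrite (reindex_onto (fun A => v |: A) (fun A => A :\ v)) /=; last first.
  by move=> A /andP[_ vA]; rewrite setD1K.
apply: eq_bigl => A; rewrite setU11 andbT; apply/andP/idP => [[s /eqP e]|s].
  have vA : v \notin A by rewrite -e setD11.
  by rewrite -(setU1K vA) -(setU1K vC) setSD.
have vA : v \notin A by apply: contra vC; apply: (subsetP s).
by rewrite setUS // setU1K.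
Qed.

Lemma sum_subsetU1' v C (F : {set V} -> K) : v \notin C ->
  \sum_(A : {set V} | (A \subset v |: C) && (v \notin A)) F A
    = \sum_(A : {set V} | A \subset C) F A.
Proof.
move=> vC; apply: eq_bigl => A; apply/andP/idP => [[s vA]|s].
  by rewrite -(setU1K vC) subsetD1 s.
rewrite (subset_trans s) ?subsetUr //; split=> //; by apply: contra vC; apply: (subsetP s).
Qed.

Lemma sum_subsetU v C (F : {set V} -> K) : v \notin C ->
  \sum_(A : {set V} | A \subset v |: C) F A
    = \sum_(A : {set V} | A \subset C) F (v |: A) + \sum_(A : {set V} | A \subset C) F A.
Proof.
by move=> vC; rewrite (bigID (fun A : {set V} => v \in A)) /= sum_subsetU1 // sum_subsetU1'.
Qed.

Lemma setU1Dl v (A C : {set V}) : v \notin A -> (v |: C) :\: A = v |: (C :\: A).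
Proof. by move=> vA; rewrite setDUl; congr (_ :|: _); apply/setDidPl; rewrite disjoints1. Qed.

Lemma setU1D1 v (A C : {set V}) : v \notin C -> (v |: C) :\: (v |: A) = C :\: A.
Proof.
move=> vC; apply/setP=> u; rewrite !inE; case: (eqVneq u v) => //= ->.
by rewrite (negPf vC) andbF.
Qed.

Lemma ninv1D v (A C : {set V}) : A \subset C ->
  ninv [set v] C = (ninv [set v] A + ninv [set v] (C :\: A))%N.
Proof. by move=> sA; rewrite /ninv !big_set1 (big_setID A) /= (setIidPr sA). Qed.

(** Graded Leibniz rule. On a face containing [v] the two terms on the right cancel summand by
    summand; on other faces the subsets of [v |: C] with and without [v] give one term each. *)
Lemma contr_wedge v k x y : homog k x ->
  contr v (wedge x y) = wedge (contr v x) y + (-1) ^+ k *: wedge x (contr v y).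
Proof.
move=> hx; apply/ffunP=> C; rewrite !ffunE.
case: (boolP (v \in C)) => vC.
  rewrite -(setD1K vC); have := setD11 v C; move: (C :\ v) => D /negbT vD {C vC}.
  rewrite !sum_subsetU // big1 ?add0r; last first.
    by move=> A _; rewrite ffunE setU11 mul0r mulr0.
  rewrite [X in _ *: (_ + X)]big1 ?addr0; last first.
    move=> A sA; have vA : v \notin A by apply: contra vD; apply: (subsetP sA).
    by rewrite setU1Dl // ffunE setU11 !mulr0.
  rewrite scaler_sumr -big_split /= big1 // => A sA.
  have vA : v \notin A by apply: contra vD; apply: (subsetP sA).
  have vDA : v \notin D :\: A by rewrite inE (negPf vD) andbF.
  rewrite setU1Dl // setU1D1 // !ffunE (negPf vA) (negPf vDA).
  have [->|xn0] := eqVneq (x (v |: A)) 0; first by rewrite !(mul0r, mulr0) scaler0 addr0.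
  rewrite -(hx _ xn0) cardsU1 vA -(ninv_sym vA) ninvUr // ninvUl //.
  rewrite /GRing.scale /= !mulrA -!exprD [X in _ + X * _]mulrAC -!exprD.
  rewrite -!mulrDl [X in X * _ * _](_ : _ = 0) ?mul0r //.
  apply/eqP; rewrite addr_eq0; apply/eqP/opp_sign.
  by rewrite !oddD /=; do 4!case: (odd _).
rewrite sum_subsetU // mulrDr mulr_sumr [X in _ + X]mulr_sumr scaler_sumr.
congr (_ + _); apply: eq_bigr => A sA.
  have vA : v \notin A by apply: contra vC; apply: (subsetP sA).
  rewrite setU1D1 // ffunE (negPf vA) ninvUl // !mulrA -!exprD.
  do 2!congr (_ * _). apply: eq_sign.
  by rewrite (ninv1D v sA) !oddD; do 3!case: (odd _).
have vA : v \notin A by apply: contra vC; apply: (subsetP sA).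
have vDA : v \notin C :\: A by rewrite inE (negPf vC) andbF.
rewrite setU1Dl // ffunE (negPf vDA) ninvUr //.
have [->|xn0] := eqVneq (x A) 0; first by rewrite !(mul0r, mulr0) scaler0.
rewrite -(hx _ xn0) -(ninv_sym vA) (ninv1D v sA) /GRing.scale /= !mulrA -!exprD.
congr (_ * _); rewrite [RHS]mulrAC -!exprD; congr (_ * _); apply: eq_sign.
by rewrite !oddD; do 4!case: (odd _).
Qed.

Lemma wedge0 x y : wedge x y set0 = x set0 * y set0.
Proof.
rewrite ffunE (eq_bigl (pred1 set0)) => [|A]; last by rewrite /= subset0.
by rewrite big_pred1_eq setD0 /ninv big_set0 expr0 mul1r.
Qed.

Lemma wedgeDl x1 x2 y : wedge (x1 + x2) y = wedge x1 y + wedge x2 y.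
Proof.
apply/ffunP=> C; rewrite !ffunE -big_split /=; apply: eq_bigr => A _.
by rewrite ffunE mulrDl mulrDr.
Qed.
Lemma wedgeZl a x y : wedge (a *: x) y = a *: wedge x y.
Proof.
apply/ffunP=> C; rewrite !ffunE scaler_sumr; apply: eq_bigr => A _.
by rewrite ffunE /GRing.scale /= -mulrA mulrCA.
Qed.
Lemma wedgeDr x y1 y2 : wedge x (y1 + y2) = wedge x y1 + wedge x y2.
Proof.
apply/ffunP=> C; rewrite !ffunE -big_split /=; apply: eq_bigr => A _.
by rewrite ffunE !mulrDr.
Qed.
Lemma wedgeZr a x y : wedge x (a *: y) = a *: wedge x y.
Proof.
apply/ffunP=> C; rewrite !ffunE scaler_sumr; apply: eq_bigr => A _.
by rewrite ffunE /GRing.scale /= 2!(mulrCA a).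
Qed.
End Chains.

Lemma disjointU1s (T : finType) (v : T) (A B : {set T}) :
  [disjoint v |: A & B] = (v \notin B) && [disjoint A & B].
Proof. by rewrite -!setI_eq0 setIUl setU_eq0 !setI_eq0 disjoints1. Qed.

Lemma disjointsU1 (T : finType) (v : T) (A B : {set T}) :
  [disjoint A & v |: B] = (v \notin A) && [disjoint A & B].
Proof. by rewrite disjoint_sym disjointU1s disjoint_sym. Qed.

(** * Boundary maps of functionals *)

Section Boundary.
Local Open Scope ring_scope.
Variables (K : fieldType) (V : finType).
Local Notation chain := {ffun {set V} -> K^o}.
Local Notation functional := {ffun V -> K^o}.
Implicit Types (A B C : {set V}) (u v w : V) (x y z : chain) (f g h : functional).
Implicit Types (L : {set {set V}}) (fs : seq functional).

Definition bdr f x : chain := \sum_v f v *: contr v x.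

Lemma bdr_is_linear f : linear (bdr f).
Proof.
move=> a x y; rewrite /bdr scaler_sumr -big_split /=; apply: eq_bigr => v _.
by rewrite linearP scalerDr !scalerA mulrC.
Qed.
HB.instance Definition _ f := GRing.isLinear.Build K chain chain _ (bdr f) (bdr_is_linear f).

Lemma bdrDf f g x : bdr (f + g) x = bdr f x + bdr g x.
Proof. by rewrite /bdr -big_split; apply: eq_bigr => v _; rewrite ffunE scalerDl. Qed.
Lemma bdrZf a f x : bdr (a *: f) x = a *: bdr f x.
Proof. by rewrite /bdr scaler_sumr; apply: eq_bigr => v _; rewrite ffunE -scalerA. Qed.

Lemma bdrZ f a x : bdr f (a *: x) = a *: bdr f x. Proof. exact: linearZ. Qed.
Lemma bdrB f x y : bdr f (x - y) = bdr f x - bdr f y. Proof. exact: linearB. Qed.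
Lemma bdr0 f : bdr f 0 = 0. Proof. exact: linear0. Qed.
Lemma vmul0 v : vmul v (0 : chain) = 0. Proof. exact: linear0. Qed.

Lemma contr_bdr v f x : contr v (bdr f x) = - bdr f (contr v x).
Proof.
rewrite /bdr linear_sum -sumrN; apply: eq_bigr => w _.
by rewrite linearZ /= contrC scalerN.
Qed.

Lemma bdrC f g x : bdr f (bdr g x) = - bdr g (bdr f x).
Proof.
rewrite {1}/bdr [X in _ = - X]linear_sum -sumrN; apply: eq_bigr => v _.
by rewrite contr_bdr linearZ /= scalerN.
Qed.

(** Anticommutation with itself only gives twice the square, which says nothing in characteristic 2;
    hence the induction on the list of vertices. *)
Lemma bdr_sq f x : bdr f (bdr f x) = 0.
Proof.
rewrite /bdr; elim: (index_enum V) => [|v s IH] in x *; first by rewrite big_nil.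
have hl (t : seq V) y1 y2 a b : \sum_(w <- t) f w *: contr w (a *: y1 + b *: y2)
   = a *: \sum_(w <- t) f w *: contr w y1 + b *: \sum_(w <- t) f w *: contr w y2.
  rewrite !scaler_sumr -big_split; apply: eq_bigr => w _ /=.
  by rewrite linearD !linearZ scalerDr /= !scalerA ![f w * _]mulrC.
rewrite [X in \sum_(_ <- _) _ *: contr _ X]big_cons -[X in _ + X]scale1r hl !big_cons.
rewrite contr_sq scaler0 add0r IH addr0 scale1r !linear_sum /=.
rewrite -big_split big1 // => w _ /=.
by rewrite [contr v (_ *: _)]linearZ /= contrC !scalerN addNr.
Qed.

Lemma bdr_vmul f v x : bdr f (vmul v x) = f v *: x - vmul v (bdr f x).
Proof.
rewrite /bdr linear_sum /= (eq_bigr (fun w => (if w == v then f w *: x else 0) - vmul v (f w *: contr w x))).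
  by rewrite sumrB -big_mkcond big_pred1_eq.
by move=> w _; rewrite contr_vmul scalerBr [vmul v (_ *: _)]linearZ; case: eqP => //; rewrite scaler0.
Qed.

Lemma bdr_wedge f k x y : homog k x ->
  bdr f (wedge x y) = wedge (bdr f x) y + (-1) ^+ k *: wedge x (bdr f y).
Proof.
move=> hx; have wsl (F : V -> chain) : wedge (\sum_v F v) y = \sum_v wedge (F v) y.
  elim/big_rec2: _ => [|v a b _ <-]; last by rewrite wedgeDl.
  by rewrite -(scale0r (0 : chain)) wedgeZl !scale0r.
have wsr (F : V -> chain) : wedge x (\sum_v F v) = \sum_v wedge x (F v).
  elim/big_rec2: _ => [|v a b _ <-]; last by rewrite wedgeDr.
  by rewrite -(scale0r (0 : chain)) wedgeZr !scale0r.
rewrite /bdr wsl wsr scaler_sumr -big_split; apply: eq_bigr => v _ /=.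
rewrite (contr_wedge v y hx) scalerDr wedgeZl wedgeZr !scalerA; congr (_ + _ *: _).
by rewrite mulrC.
Qed.

Lemma bdrE f x B :
  bdr f x B = \sum_(v | v \notin B) f v * ((-1) ^+ ninv [set v] B * x (v |: B)).
Proof.
rewrite /bdr sum_ffunE [RHS]big_mkcond; apply: eq_bigr => v _.
by rewrite !ffunE; case: (v \in B); rewrite /= ?scaler0.
Qed.

Lemma bdr_neq0 f x B : bdr f x B != 0 -> exists2 v, v \notin B & x (v |: B) != 0.
Proof.
move=> h; case: (pickP (fun v => (v \notin B) && (x (v |: B) != 0))) => [v /andP[]|no]; first by exists v.
case/eqP: h; rewrite bdrE big1 // => v vB; move: (no v); rewrite vB /= => /negbFE/eqP ->.
by rewrite !mulr0.
Qed.

Lemma vmul_neq0 v x B : vmul v x B != 0 -> (v \in B) && (x (B :\ v) != 0).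
Proof. by rewrite ffunE; case: (v \in B); rewrite ?eqxx // mulf_eq0 negb_or => /andP[]. Qed.

Lemma contr_neq0 v x B : contr v x B != 0 -> (v \notin B) && (x (v |: B) != 0).
Proof. by rewrite ffunE; case: (v \in B); rewrite ?eqxx // mulf_eq0 negb_or => /andP[]. Qed.

Definition chains_of L k x := forall A, x A != 0 -> A \in L /\ #|A| = k.

Lemma chains_of0 L k : chains_of L k 0.
Proof. by move=> A; rewrite ffunE eqxx. Qed.
Lemma chains_ofD L k x y : chains_of L k x -> chains_of L k y -> chains_of L k (x + y).
Proof.
move=> hx hy A; rewrite ffunE; have [->|/hx //] := eqVneq (x A) 0.
by rewrite add0r => /hy.
Qed.
Lemma chains_ofZ L k a x : chains_of L k x -> chains_of L k (a *: x).
Proof. by move=> hx A; rewrite ffunE mulf_eq0 negb_or => /andP[_ /hx]. Qed.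
Lemma chains_ofN L k x : chains_of L k x -> chains_of L k (- x).
Proof. by rewrite -scaleN1r; apply: chains_ofZ. Qed.
Lemma chains_ofB L k x y : chains_of L k x -> chains_of L k y -> chains_of L k (x - y).
Proof. by move=> hx hy; apply: chains_ofD => //; apply: chains_ofN. Qed.
Lemma chains_of_sum L k (I : finType) (F : I -> chain) :
  (forall i, chains_of L k (F i)) -> chains_of L k (\sum_i F i).
Proof.
move=> h; elim/big_ind: _ => //; [exact: chains_of0 | exact: chains_ofD].
Qed.
Lemma chains_ofS L L' k x : L \subset L' -> chains_of L k x -> chains_of L' k x.
Proof. by move=> /subsetP s hx A /hx[/s]. Qed.
Lemma chains_of_homog L k x : chains_of L k x -> homog k x.
Proof. by move=> hx A /hx[]. Qed.

Definition down_closed L := forall A B, A \in L -> B \subset A -> B \in L.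

Lemma chains_of_bdr L k f x : down_closed L -> chains_of L k.+1 x -> chains_of L k (bdr f x).
Proof.
move=> dL hx B /bdr_neq0[v vB /hx[vBL]]; rewrite cardsU1 vB => -[<-]; split=> //.
by apply: dL vBL (subsetUr _ _).
Qed.

Lemma homog_bd0 f x : homog 0 x -> bdr f x = 0.
Proof.
move=> hx; apply/ffunP=> B; rewrite ffunE; apply/eqP/negPn/negP => /bdr_neq0[v vB /hx].
by rewrite cardsU1 vB.
Qed.

Definition bdl fs x := foldr bdr x fs.

Lemma bdl_is_linear fs : linear (bdl fs).
Proof. by elim: fs => [|f fs IH] a x y //=; rewrite IH linearP. Qed.
HB.instance Definition _ fs := GRing.isLinear.Build K chain chain _ (bdl fs) (bdl_is_linear fs).

Lemma bdlZ fs a x : bdl fs (a *: x) = a *: bdl fs x. Proof. exact: linearZ. Qed.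
Lemma bdl0 fs : bdl fs 0 = 0. Proof. exact: linear0. Qed.

Lemma bdr_bdl f fs x : bdr f (bdl fs x) = (-1) ^+ size fs *: bdl fs (bdr f x).
Proof.
elim: fs => [|g fs IH] /=; first by rewrite expr0 scale1r.
by rewrite bdrC IH linearZ /= exprS mulN1r scaleNr.
Qed.

Lemma bdr_bdl_mem f fs x : f \in fs -> bdr f (bdl fs x) = 0.
Proof.
elim: fs => //= g fs IH; rewrite inE => /orP[/eqP->|ffs]; first exact: bdr_sq.
by rewrite bdrC IH // linear0 oppr0.
Qed.

Lemma bdl_rcons fs f x : bdl (rcons fs f) x = bdl fs (bdr f x).
Proof. by rewrite /bdl foldr_rcons. Qed.

Lemma chains_of_bdl L k fs x : down_closed L -> chains_of L (k + size fs) x -> chains_of L k (bdl fs x).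
Proof.
move=> dL; elim: fs k => [|f fs IH] k /=; first by rewrite addn0.
by rewrite addnS -addSn => /IH; apply: chains_of_bdr.
Qed.

Definition ones : functional := [ffun => 1].

Definition acyclic L k := forall x, chains_of L k x -> bdr ones x = 0 ->
  exists2 y, chains_of L k.+1 y & x = bdr ones y.

(** The bound [D - #|s|] replaces the dimension of the link, so the condition passes to cone bases
    and vertex deletions at the cost of one unit of [D]. *)
Definition cm_class L D := down_closed L /\
  forall s k, s \in L -> (k + #|s| < D)%N -> acyclic (link L s) k.

Lemma link_in L s B : down_closed L -> (B \in link L s) = [disjoint s & B] && (s :|: B \in L).
Proof.
move=> dL; rewrite inE; case: (boolP (s :|: B \in L)) => [h|]; last by rewrite !andbF.
by rewrite (dL _ _ h (subsetUr _ _)).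
Qed.

Lemma link_down L s : down_closed L -> down_closed (link L s).
Proof.
move=> dL A B; rewrite !link_in // => /andP[dA h] sB; apply/andP; split.
  by rewrite disjoint_sym (disjointWl sB) // disjoint_sym.
by apply: dL h _; rewrite setUS.
Qed.

Definition cone_at L v := forall A, A \in L -> v |: A \in L.

Lemma chains_of_vmul L k v x : cone_at L v -> chains_of L k x ->
  chains_of L k.+1 (vmul v x).
Proof.
move=> cL hx A /vmul_neq0/andP[vA /hx[/cL]]; rewrite setD1K // => -> <-.
by rewrite (cardsD1 v A) vA.
Qed.

Lemma cone_acyclic L v k : cone_at L v -> acyclic L k.
Proof.
move=> cL x hx x0; exists (vmul v x); first exact: chains_of_vmul.
by rewrite bdr_vmul x0 linear0 subr0 ffunE scale1r.
Qed.

End Boundary.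

(** * Elimination of functionals; stars as cones *)

Section Kernels.
Local Open Scope ring_scope.
Variables (K : fieldType) (V : finType).
Local Notation chain := {ffun {set V} -> K^o}.
Local Notation functional := {ffun V -> K^o}.
Implicit Types (A B C U s : {set V}) (u v w : V) (x y z : chain) (f g h : functional).
Implicit Types (L : {set {set V}}) (fs : seq functional).

Definition pivot f v g : functional := f v *: g - g v *: f.

(* All leading minors of the matrix (f v), f in fs and v running over distinct vertices of U,
   are nonzero; the minors are expanded by one step of Gaussian elimination at v. *)
Inductive good : {set V} -> seq functional -> Prop :=
| good_nil U : good U [::]
| good_cons U f fs :
    (forall v, v \in U -> f v != 0 /\ good (U :\ v) (map (pivot f v) fs)) -> good U (f :: fs).

Lemma good_consP U f fs v : good U (f :: fs) -> v \in U ->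
  f v != 0 /\ good (U :\ v) (map (pivot f v) fs).
Proof. by move=> h; inversion h; subst; auto. Qed.

Lemma good_prefix U fs gs : good U (fs ++ gs) -> good U fs.
Proof.
have [n] := ubnP (size fs); elim: n fs gs U => // n IH [|f fs] gs U /=; first by left.
rewrite ltnS => sz h; right=> v vU; have [fv] := good_consP h vU.
by rewrite map_cat; split=> //; apply: IH b; rewrite size_map.
Qed.

Lemma pivot_apex f v g : pivot f v g v = 0.
Proof. by rewrite !ffunE /GRing.scale /= mulrC subrr. Qed.

Lemma bdr_pivot f v g x : bdr (pivot f v g) x = f v *: bdr g x - g v *: bdr f x.
Proof. by rewrite bdrDf -scaleNr !bdrZf scaleNr. Qed.

(** Under an outer boundary at [f] the multiples of [f] in the pivots vanish, so each pivot acts as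
    [f v] times the original functional. *)
Lemma bdr_bdl_pivot f v fs x :
  bdr f (bdl (map (pivot f v) fs) x) = f v ^+ size fs *: bdr f (bdl fs x).
Proof.
elim: fs => [|g fs IH] /=; first by rewrite expr0 scale1r.
rewrite bdr_pivot bdrB !bdrZ bdr_sq scaler0 subr0 bdrC IH.
by rewrite bdrZ -scalerN -bdrC scalerA exprS.
Qed.

Lemma bdl_vmul fs v x : (forall f, f \in fs -> f v = 0) ->
  bdl fs (vmul v x) = (-1) ^+ size fs *: vmul v (bdl fs x).
Proof.
elim: fs => [|f fs IH] h /=; first by rewrite scale1r.
rewrite IH => [|g gfs]; last by apply: h; rewrite inE gfs orbT.
rewrite bdrZ bdr_vmul h ?mem_head // scale0r sub0r scalerN exprS mulN1r.
by rewrite scaleNr.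
Qed.

(* The part of x carried by the faces that avoid v. *)
Definition off_apex v x : chain := x - vmul v (contr v x).

Lemma off_apexE v x A : off_apex v x A = if v \in A then 0 else x A.
Proof.
rewrite !ffunE; case: (boolP (v \in A)) => vA; last by rewrite oppr0 addr0.
by rewrite setD11 setD1K // mulrA -exprD addnn -signr_odd odd_double mul1r subrr.
Qed.

Lemma vmul_off_apex v x : vmul v (off_apex v x) = vmul v x.
Proof.
apply/ffunP=> A; rewrite [LHS]ffunE [RHS]ffunE; case: (v \in A) => //.
by rewrite off_apexE setD11.
Qed.

Lemma bdr_off_apex f v x : f v = 0 -> bdr f x = 0 -> bdr f (off_apex v x) = 0.
Proof.
move=> fv fx; rewrite bdrB bdr_vmul fx fv scale0r sub0r.
have := contr_bdr v f x; rewrite fx linear0 => /esym/eqP; rewrite oppr_eq0 => /eqP ->.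
by rewrite vmul0 subr0 oppr0.
Qed.

(** The part of [x] off [v] is killed by the pivots, so it vanishes by induction; then
    [vmul v x = 0], and the homotopy formula reduces to [f v *: x = 0]. *)
Lemma good_full U fs k x : good U fs -> (#|U| <= size fs)%N ->
  (forall A, x A != 0 -> A \subset U) -> homog k.+1 x ->
  (forall f, f \in fs -> bdr f x = 0) -> x = 0.
Proof.
have [n] := ubnP (size fs); elim: n fs U x => // n IH fs U x szn gU sz sU hx h0.
have [U0|[v vU]] := set_0Vmem U.
  apply/ffunP=> A; rewrite ffunE; apply/eqP/negPn/negP => xA.
  by have := hx _ xA; have := sU _ xA; rewrite U0 subset0 => /eqP ->; rewrite cards0.
case: fs => [|f fs] in szn gU sz h0 *; first by rewrite leqn0 cards_eq0 in sz; rewrite (eqP sz) inE in vU.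
have [fv gU'] := good_consP gU vU.
have z0 : off_apex v x = 0.
  apply: (IH (map (pivot f v) fs) (U :\ v)) => //.
  - by rewrite size_map.
  - by rewrite size_map; move: sz; rewrite (cardsD1 v) vU.
  - move=> A; rewrite off_apexE; case: ifP => [|vA /sU sA]; rewrite ?eqxx //.
    by rewrite subsetD1 sA vA.
  - by move=> A; rewrite off_apexE; case: ifP => [|_ /hx //]; rewrite eqxx.
  move=> _ /mapP[g gfs ->]; apply: bdr_off_apex; first exact: pivot_apex.
  by rewrite bdr_pivot !h0 ?mem_head ?inE ?gfs ?orbT // !scaler0 subr0.
have := bdr_vmul f v x; rewrite -vmul_off_apex z0 vmul0 bdr0 h0 ?mem_head //.
by rewrite vmul0 subr0 => /esym/eqP; rewrite scaler_eq0 (negPf fv) => /eqP.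
Qed.

Definition star L s : {set {set V}} := [set A | s :|: A \in L].

(* For fs = [:: f] with f nowhere zero this is the vanishing of reduced homology below D; in
   general it says that the module of chains over the exterior algebra on fs is free in low degrees. *)
Definition kernels_exact fs L D := forall k x, (k + size fs <= D)%N -> chains_of L k x ->
  (forall f, f \in fs -> bdr f x = 0) ->
  exists2 y, chains_of L (k + size fs) y & x = bdl fs y.

Lemma star_down L s : down_closed L -> down_closed (star L s).
Proof. by move=> dL A B; rewrite !inE => h sB; apply: dL h _; rewrite setUS. Qed.

Lemma star_cone L s v : v \in s -> cone_at (star L s) v.
Proof.
move=> vs A; rewrite !inE => h.
by have /setUidPl e : [set v] \subset s; rewrite ?sub1set // setUA e.
Qed.

Definition star_base L s v : {set {set V}} := [set A in star L s | v \notin A].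

(** A link in the base is the link in [L] of [v |: t], one vertex larger, unless [s] has a further
    vertex outside [t]; that vertex is then a cone point. *)
Lemma star_base_class L D s v : cm_class K L D -> v \in s -> cm_class K (star_base L s v) D.-1.
Proof.
move=> [dL hL] vs; split=> [A B|t k].
  rewrite inE => /andP[/(star_down dL) h vA] sB; rewrite inE h //=.
  by apply: contra vA; apply: (subsetP sB).
have dK : down_closed (star_base L s v).
  move=> A B; rewrite inE => /andP[/(star_down dL) h vA] sB; rewrite inE h //=.
  by apply: contra vA; apply: (subsetP sB).
rewrite inE => /andP[]; rewrite inE => stL vt ktD.
have vtD : (k + #|v |: t| < D)%N by rewrite cardsU1 vt addnS; case: (D) ktD.
case: (boolP (s :\ v \subset t)) => [sub|/subsetPn[w]].
  have svt : s :|: t = v |: t.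
    apply/setP=> u; rewrite !inE; case: (eqVneq u v) => [->|uv] /=; first by rewrite vs.
    case: (boolP (u \in s)) => //= us; apply/esym/(subsetP sub); by rewrite !inE uv.
  have -> : link (star_base L s v) t = link L (v |: t).
    apply/setP=> B; rewrite !link_in // !inE setUA svt disjointU1s (negPf vt) /=.
    by case: (v \in B); rewrite ?andbF ?andbT.
  by apply: hL => //; rewrite -svt.
rewrite !inE => /andP[wv ws] wt.
apply: (@cone_acyclic _ _ _ w) => B; rewrite !link_in // !inE.
case/andP=> dtB /andP[h hv]; apply/and3P; split.
- by rewrite disjointsU1 wt.
- by have /setUidPl e : [set w] \subset s; rewrite ?sub1set // (setUCA t) setUA e.
by move: hv; rewrite !negb_or eq_sym wv.
Qed.
End Kernels.

(** * Exactness of iterated boundaries *)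

Section Exactness.
Local Open Scope ring_scope.
Variables (K : fieldType) (V : finType).
Local Notation chain := {ffun {set V} -> K^o}.
Local Notation functional := {ffun V -> K^o}.
Implicit Types (A B C U s : {set V}) (u v w : V) (x y z : chain) (f g h : functional).
Implicit Types (L : {set {set V}}) (fs : seq functional) (t : {set V} -> chain).

Lemma kernels_exact_nil L D : @kernels_exact K V [::] L D.
Proof. by move=> k x _ hx _; exists x; rewrite // addn0. Qed.

(** The star is a cone with apex [v]. The part of [x] off [v] lies in the base and is killed by the
    pivots, a sequence shorter by one; if [u] is its preimage there, a multiple of [vmul v u] is a
    preimage of [x]. *)
Lemma star_kernels_exact L D U fs s : cm_class K L D ->
  (forall A, A \in L -> A \subset U) -> good U fs ->
  (forall fs' U' L' D', (size fs' < size fs)%N -> good U' fs' -> cm_class K L' D' ->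
     (forall A, A \in L' -> A \subset U') -> kernels_exact fs' L' D') ->
  s != set0 -> kernels_exact fs (star L s) D.
Proof.
case: fs => [|f fs] cL sU gfs IH /set0Pn[v vs]; first exact: kernels_exact_nil.
move=> k x szk hx h0; have [dL _] := cL.
have [sL|sL] := boolP (s \in L); last first.
  exists 0; first exact: chains_of0.
  rewrite bdl0; apply/ffunP=> A; rewrite ffunE; apply/eqP/negPn/negP => /hx[].
  by rewrite inE => /dL/(_ (subsetUl _ _)); rewrite (negPf sL).
have vU : v \in U by apply: (subsetP (sU _ sL)).
have [fv gfs'] := good_consP gfs vU.
pose fs' := map (pivot f v) fs; pose z := off_apex v x.
have hz : chains_of (star_base L s v) k z.
  move=> A; rewrite off_apexE; case: ifP; rewrite ?eqxx // => vA /hx[hA <-].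
  by rewrite inE hA vA.
have z0 g : g \in fs' -> bdr g z = 0.
  move=> /mapP[g' gfs0 ->]; apply: bdr_off_apex; first exact: pivot_apex.
  by rewrite bdr_pivot !h0 ?mem_head ?inE ?gfs0 ?orbT // !scaler0 subr0.
have szk' : (k + size fs' <= D.-1)%N.
  by move: szk; rewrite size_map /= addnS; case: (D).
have [||u hu zu] := IH fs' (U :\ v) _ _ _ gfs' (star_base_class cL vs) _ k z szk' hz z0.
- by rewrite size_map.
- move=> A; rewrite inE => /andP[]; rewrite inE => hA vA.
  by rewrite subsetD1 vA andbT (subset_trans _ (sU _ hA)) // subsetUr.
(* The factors undo the homotopy, move [vmul v] past the pivots, and replace the pivots by [fs]
   under the boundary at [f]. *)
pose a := (f v)^-1 * (-1) ^+ size fs * f v ^+ size fs.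
exists (a *: vmul v u).
  rewrite addnS; apply/chains_ofZ/chains_of_vmul; first exact: star_cone.
  move: hu; rewrite size_map; apply: chains_ofS.
  by apply/subsetP => A; rewrite inE => /andP[].
rewrite bdlZ /=.
have -> : x = (f v)^-1 *: bdr f (vmul v z).
  by rewrite vmul_off_apex bdr_vmul h0 ?mem_head // vmul0 subr0 scalerA mulVf // scale1r.
have -> : vmul v z = (-1) ^+ size fs *: bdl fs' (vmul v u).
  rewrite bdl_vmul; last by move=> g /mapP[g' _ ->]; rewrite pivot_apex.
  by rewrite size_map -zu scalerA -exprD addnn -signr_odd odd_double scale1r.
by rewrite bdrZ bdr_bdl_pivot !scalerA.
Qed.

(** At each fixed face [A] this is the boundary with respect to [s] (see [tdiffE]), so it squares to
    zero; it commutes with every [bdr f]. *)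
Definition tdiff t s : chain := \sum_(v | v \notin s) (-1) ^+ ninv [set v] s *: t (v |: s).

Definition slice t A : chain := [ffun s => t s A].

(* Degree (j, k) of the double complex that resolves the chains of L by the chains of the stars
   of its faces: t attaches to a face s with j vertices a chain of the star of s. *)
Definition cover_chain L j k t := forall s,
  (#|s| = j -> chains_of (star L s) k (t s)) /\ (#|s| <> j -> t s = 0).

Lemma tdiffE t s A : tdiff t s A = bdr (ones K V) (slice t A) s.
Proof.
rewrite bdrE sum_ffunE; apply: eq_bigr => v vs.
by rewrite !ffunE mul1r.
Qed.

Lemma tdiff_sq t s : tdiff (tdiff t) s = 0.
Proof.
apply/ffunP=> A; rewrite tdiffE (_ : slice (tdiff t) A = bdr (ones K V) (slice t A)).
  by rewrite bdr_sq !ffunE.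
by apply/ffunP=> s'; rewrite [LHS]ffunE tdiffE.
Qed.

Lemma tdiffB t1 t2 s : tdiff (fun s' => t1 s' - t2 s') s = tdiff t1 s - tdiff t2 s.
Proof. by rewrite /tdiff -sumrB; apply: eq_bigr => v _; rewrite scalerBr. Qed.

Lemma eq_tdiff t1 t2 s : t1 =1 t2 -> tdiff t1 s = tdiff t2 s.
Proof. by move=> e; apply: eq_bigr => v _; rewrite e. Qed.

Lemma bdr_tdiff f t s : bdr f (tdiff t s) = tdiff (fun s' => bdr f (t s')) s.
Proof. by rewrite /tdiff linear_sum; apply: eq_bigr => v _; rewrite -bdrZ. Qed.

Lemma cover_chain_bdr L j k f t : down_closed L -> cover_chain L j k.+1 t ->
  cover_chain L j k (fun s => bdr f (t s)).
Proof.
move=> dL ht s; have [h1 h2] := ht s; split=> [/h1|/h2 ->]; last by rewrite bdr0.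
by apply: chains_of_bdr; apply: star_down.
Qed.

Lemma cover_chain_tdiff L j k t : down_closed L -> cover_chain L j.+1 k t ->
  cover_chain L j k (tdiff t).
Proof.
move=> dL ht s; split=> hs.
  rewrite /tdiff big_mkcond; apply: chains_of_sum => v.
  case: ifP => vs; last exact: chains_of0.
  apply/chains_ofZ; have [h1 _] := ht (v |: s).
  apply: chains_ofS (h1 _); last by rewrite cardsU1 vs hs.
  by apply/subsetP => A; rewrite !inE => h; apply: dL h _; rewrite setSU // subsetUr.
rewrite /tdiff big1 // => v vs; have [_ ->] := ht (v |: s); first by rewrite scaler0.
by rewrite cardsU1 vs => -[].
Qed.

Lemma class_acyclic L D j : cm_class K L D -> (j < D)%N -> acyclic K L j.
Proof.
move=> [dL hL] jD x hx x0; case: (pickP (fun A => x A != 0)) => [A /hx[AL _]|no].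
  have L0 : set0 \in L by apply: dL AL (sub0set _).
  have := hL set0 j L0; rewrite cards0 addn0 => /(_ jD x).
  have -> : link L set0 = L.
    by apply/setP=> B; rewrite link_in // -setI_eq0 set0I eqxx set0U.
  exact.
exists 0; rewrite ?bdr0; first exact: chains_of0.
by apply/ffunP=> A; rewrite ffunE; apply/eqP/negPn; rewrite no.
Qed.

Lemma star_set0 L : star L set0 = L.
Proof. by apply/setP=> A; rewrite inE set0U. Qed.

(** At a fixed face [A] the indices [s] range over the star of [A]. This is a cone when [A] is
    nonempty and [L] itself otherwise; the bound on [j] enters in the latter case. *)
Lemma cover_exact0 L D j k t : cm_class K L D -> (j < D)%N -> cover_chain L j k t ->
  (forall s, tdiff t s = 0) ->
  exists2 t', cover_chain L j.+1 k t' & forall s, t s = tdiff t' s.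
Proof.
move=> cL jD ht t0.
have /fin_all_exists[tau htau] A : exists tau : chain,
    (tau != 0 -> #|A| = k) /\ chains_of (star L A) j.+1 tau /\ slice t A = bdr (ones K V) tau.
  have sz : chains_of (star L A) j (slice t A).
    move=> s; rewrite ffunE => tsA; have [h1 h2] := ht s.
    have [sj|/eqP sj] := eqVneq #|s| j; last by rewrite h2 // ffunE eqxx in tsA.
    by have [] := h1 sj A tsA; rewrite !inE setUC.
  have cyc : bdr (ones K V) (slice t A) = 0.
    by apply/ffunP=> s; rewrite -tdiffE t0 !ffunE.
  have [Ak|Ak] := eqVneq #|A| k; last first.
    exists 0; rewrite eqxx; split=> //; split; first exact: chains_of0.
    rewrite bdr0; apply/ffunP=> s; rewrite !ffunE; apply/eqP/negPn/negP => tsA.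
    have [h1 h2] := ht s.
    have [sj|/eqP sj] := eqVneq #|s| j; last by rewrite h2 // ffunE eqxx in tsA.
    by have [_ e] := h1 sj A tsA; rewrite e eqxx in Ak.
  have ac : acyclic K (star L A) j.
    have [->|[v vA]] := set_0Vmem A; first by rewrite star_set0; apply: class_acyclic cL jD.
    by apply: (@cone_acyclic _ _ _ v); apply: star_cone.
  by have [tau h e] := ac _ sz cyc; exists tau.
exists (fun s => [ffun A => tau A s]) => [s|s]; last first.
  apply/ffunP=> A; rewrite tdiffE; have [_ [_ e]] := htau A.
  rewrite (_ : slice _ A = tau A) -?e ?ffunE //.
  by apply/ffunP=> s'; rewrite !ffunE.
split=> sj; last first.
  apply/ffunP=> A; rewrite !ffunE; apply/eqP/negPn/negP => h.
  by have [_ [/(_ s h)[_ /sj]]] := htau A.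
move=> A; rewrite ffunE => h; have [hk [/(_ s h)[]]] := htau A.
rewrite !inE setUC => h' _ _; split=> //; apply: hk; apply: contraNneq h => ->.
by rewrite ffunE.
Qed.

(* Adding g to fs: lift t to t', note that g t' is again a cycle of lower degree, lift it to y' by
   induction, and use that stars, being cones, are known to be exact to write y' = g u. Then
   t' - tdiff u is the required lift. *)
Lemma cover_exact L D fs : cm_class K L D ->
  (forall fs1 fs2 s, fs = fs1 ++ fs2 -> s != set0 -> kernels_exact fs1 (star L s) D) ->
  forall j k t, (j + k < D)%N -> (k + size fs <= D.+1)%N -> cover_chain L j k t ->
  (forall f s, f \in fs -> bdr f (t s) = 0) -> (forall s, tdiff t s = 0) ->
  exists t', [/\ cover_chain L j.+1 k t', forall f s, f \in fs -> bdr f (t' s) = 0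
             & forall s, t s = tdiff t' s].
Proof.
move=> cL; have [dL _] := cL.
elim/last_ind: fs => [|fs g IHfs] hst j k t jkD ksz ht tf t0.
  have jD : (j < D)%N by apply: leq_ltn_trans jkD; rewrite leq_addr.
  by have [t' h1 h2] := cover_exact0 cL jD ht t0; exists t'.
have {}IHfs := IHfs (fun fs1 fs2 s e => hst fs1 (rcons fs2 g) s (etrans (congr1 (rcons^~ g) e) (rcons_cat _ _ _))).
rewrite size_rcons in ksz.
elim: k j t jkD ksz ht tf t0 => [|k IHk] j t jkD ksz ht tf t0.
  have [|t' [h1 h2 h3]] := IHfs j 0%N t jkD (ltnW ksz) ht _ t0.
    by move=> f s ffs; apply: tf; rewrite mem_rcons inE ffs orbT.
  exists t'; split=> // f s _; have [e|/eqP ne] := eqVneq #|s| j.+1.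
    by apply: homog_bd0; have [/(_ e)/chains_of_homog] := h1 s.
  by have [_ /(_ ne) ->] := h1 s; rewrite bdr0.
have ksz' : (k.+1 + size fs <= D.+1)%N by move: ksz; rewrite addnS; apply: ltnW.
have [|t' [h1 h2 h3]] := IHfs j k.+1 t jkD ksz' ht _ t0.
  by move=> f s ffs; apply: tf; rewrite mem_rcons inE ffs orbT.
have gr : g \in rcons fs g by rewrite mem_rcons mem_head.
have [|||||y' [y1 y2 y3]] := IHk j.+1 (fun s => bdr g (t' s)).
- by rewrite addSnnS.
- by move: ksz; rewrite addSn => /ltnW.
- exact: cover_chain_bdr.
- move=> f s; rewrite mem_rcons inE => /orP[/eqP->|ffs]; first exact: bdr_sq.
  by rewrite bdrC h2 // bdr0 oppr0.
- by move=> s; rewrite -bdr_tdiff -h3 tf.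
have /fin_all_exists[u hu] s : exists us : chain,
    [/\ #|s| = j.+2 -> chains_of (star L s) k.+1 us, #|s| <> j.+2 -> us = 0,
        forall f, f \in fs -> bdr f us = 0 & bdr g us = y' s].
  have [sj|/eqP sj] := eqVneq #|s| j.+2; last first.
    exists 0; split=> //; first by move=> f _; rewrite bdr0.
    by have [_ ->] := y1 s; rewrite ?bdr0.
  have sn0 : s != set0 by rewrite -card_gt0 sj.
  have [/(_ sj) hy _] := y1 s.
  have [||w hw e] := hst (rcons fs g) [::] s _ sn0 k (y' s) _ hy (fun f => y2 f s).
  - by rewrite cats0.
  - by rewrite size_rcons -ltnS -addSn.
  (* Everything in [rcons fs g] except [g] is applied to [w], so [fs] kills the result; the sign
     brings [g] to the innermost place. *)
  exists ((-1) ^+ size fs *: bdl fs w); split=> //.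
  - move=> _; apply/chains_ofZ/chains_of_bdl; first exact: star_down.
    by move: hw; rewrite size_rcons addSnnS.
  - by move=> f ffs; rewrite bdrZ bdr_bdl_mem // scaler0.
  by rewrite bdrZ bdr_bdl scalerA -exprD addnn -signr_odd odd_double scale1r e bdl_rcons.
have hcu : cover_chain L j.+2 k.+1 u by move=> s; have [] := hu s.
have hcdu := cover_chain_tdiff dL hcu.
exists (fun s => t' s - tdiff u s); split.
- move=> s; have [a1 a2] := h1 s; have [b1 b2] := hcdu s; split=> hs.
    by apply: chains_ofB; [apply: a1 | apply: b1].
  by rewrite a2 // b2 // subr0.
- move=> f s; rewrite mem_rcons inE => /orP[/eqP->|ffs]; rewrite bdrB bdr_tdiff.
    rewrite (eq_tdiff _ (t2 := y')); last by move=> s'; have [] := hu s'.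
    by rewrite -y3 subrr.
  rewrite h2 // sub0r (eq_tdiff _ (t2 := fun=> 0)); last by move=> s'; have [_ _ hz _] := hu s'; apply: hz.
  by rewrite /tdiff big1 ?oppr0 // => v _; rewrite scaler0.
by move=> s; rewrite tdiffB tdiff_sq subr0.
Qed.

(** Placed at [s = set0], [x] lifts to chains in the stars of the vertices that are killed by [fs];
    these have preimages by the cone case, and the sum of the preimages is one for [x]. *)
Theorem class_kernels_exact L D U fs : cm_class K L D ->
  (forall A, A \in L -> A \subset U) -> good U fs -> kernels_exact fs L D.
Proof.
have [n] := ubnP (size fs); elim: n fs U L D => // n IH fs U L D szn cL sU gfs.
have [dL _] := cL.
have [->|fs0] := eqVneq fs [::]; first exact: kernels_exact_nil.
have sfs : (0 < size fs)%N by case: (fs) fs0.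
have hst fs1 fs2 s : fs = fs1 ++ fs2 -> s != set0 -> kernels_exact fs1 (star L s) D.
  move=> e; apply: (star_kernels_exact cL sU).
    by move: gfs; rewrite e; apply: good_prefix.
  move=> fs' U' L' D' sz' gd cl sub; apply: (IH _ U') => //; apply: leq_trans sz' _.
  by rewrite -ltnS; apply: leq_trans szn; rewrite e size_cat ltnS leq_addr.
move=> k x szk hx x0.
have kD : (0 + k < D)%N.
  by rewrite add0n; apply: leq_trans szk; rewrite -addn1 leq_add2l.
have [||||t' [h1 h2 h3]] := cover_exact cL hst (t := fun s => if s == set0 then x else 0) kD.
- by apply: leq_trans szk _.
- move=> s; have [->|sn] := eqVneq s set0; first by rewrite star_set0 cards0; split.
  by split=> // e; case/eqP: sn; apply: cards0_eq.
- by move=> f s ffs; case: ifP => _; rewrite ?x0 ?bdr0.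
- move=> s; rewrite /tdiff big1 // => v _; case: eqP => [e|]; last by rewrite scaler0.
  by have := setU11 v s; rewrite e inE.
have /fin_all_exists[y hy] v : exists y, chains_of L (k + size fs) y /\ t' [set v] = bdl fs y.
  have v0 : [set v] != set0 :> {set V} by apply/set0Pn; exists v; rewrite set11.
  have [/(_ (cards1 v)) ht _] := h1 [set v].
  have [|y hy e] := hst fs [::] _ _ v0 k _ szk ht (fun f => h2 f _); first by rewrite cats0.
  exists y; split=> //; apply: chains_ofS hy; apply/subsetP=> A; rewrite inE => h.
  by apply: dL h (subsetUr _ _).
exists (\sum_v y v); first by apply: chains_of_sum => v; have [] := hy v.
have := h3 set0; rewrite eqxx => ->; rewrite /tdiff linear_sum /=.
apply: eq_big => [v|v _]; first by rewrite inE.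
by rewrite setU0 /ninv big_set1 big_set0 scale1r; have [_ ->] := hy v.
Qed.
End Exactness.

(** * Leading words *)

Section Leads.
Local Open Scope ring_scope.
Variables (K : fieldType) (V : finType).
Local Notation chain := {ffun {set V} -> K^o}.
Local Notation functional := {ffun V -> K^o}.
Implicit Types (A B C U s : {set V}) (u v : V) (x y z : chain) (f g h : functional).
Implicit Types (L X Y : {set {set V}}) (fs gs : seq functional) (w : seq bool) (W : {vspace chain}).

(* In the exterior basis dual to fs, w is the indicator word of the lexicographically first
   monomial occurring in x. *)
Fixpoint lead fs w x : Prop :=
  match fs, w with
  | f :: fs', b :: w' => if b then lead fs' w' (bdr f x) else bdr f x = 0 /\ lead fs' w' x
  | [::], [::] => x <> 0
  | _, _ => False
  end.

Lemma lead_size fs w x : lead fs w x -> size w = size fs.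
Proof.
elim: fs w x => [|f fs IH] [|[] w] x //=; first by move=> /IH ->.
by move=> [_ /IH ->].
Qed.

Lemma lead_neq0 fs w x : lead fs w x -> x <> 0.
Proof.
elim: fs w x => [|f fs IH] [|[] w] x //=; last by move=> [_ /IH].
by move=> /IH h x0; apply: h; rewrite x0 bdr0.
Qed.

Lemma leadZ a fs w x : a != 0 -> lead fs w x -> lead fs w (a *: x).
Proof.
move=> a0; elim: fs w x => [|f fs IH] [|[] w] x //=.
- by move=> /eqP h; apply/eqP; rewrite scaler_eq0 negb_or a0.
- by move=> /IH; rewrite bdrZ.
by move=> [h /IH]; rewrite bdrZ h scaler0.
Qed.

Lemma lead_sign n fs w x : lead fs w x -> lead fs w ((-1) ^+ n *: x).
Proof. by apply: leadZ; rewrite signr_eq0. Qed.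

(* fs spans the space of functionals. *)
Definition detects fs := forall x k, homog k.+1 x -> (forall f, f \in fs -> bdr f x = 0) -> x = 0.

Lemma detects_homog0 fs k x : detects fs -> homog k x -> (forall f, f \in fs -> bdr f x = 0) ->
  homog 0 x.
Proof.
by case: k => // k df hx x0 A; rewrite (df x k hx x0) ffunE eqxx.
Qed.

Lemma homog_bdr k f x : homog k x -> homog k.-1 (bdr f x).
Proof.
by move=> hx B /bdr_neq0[v vB /hx]; rewrite cardsU1 vB => <-.
Qed.

Lemma homog0P x : homog 0 x -> x <> 0 -> x set0 != 0.
Proof.
move=> hx x0; apply/eqP => h0; apply: x0; apply/ffunP=> A; rewrite ffunE.
apply/eqP/negPn/negP => xA; have /eqP := hx _ xA; rewrite cards_eq0 => /eqP e.
by rewrite e h0 eqxx in xA.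
Qed.

Lemma killed_bdr f gs x : (forall g, g \in gs -> bdr g x = 0) ->
  forall g, g \in rcons gs f -> bdr g (bdr f x) = 0.
Proof.
move=> h g; rewrite mem_rcons inE => /orP[/eqP->|ggs]; first exact: bdr_sq.
by rewrite bdrC h // bdr0 oppr0.
Qed.

Lemma killed_rcons f gs x : (forall g, g \in gs -> bdr g x = 0) -> bdr f x = 0 ->
  forall g, g \in rcons gs f -> bdr g x = 0.
Proof. by move=> h h0 g; rewrite mem_rcons inE => /orP[/eqP->|/h]. Qed.

(** [gs] collects the functionals already passed: whether applied or found to vanish, each kills the
    current chain from then on, so at the end only a multiple of the empty face is left. *)
Lemma lead_count_gen gs fs w x k : detects (gs ++ fs) -> homog k x ->
  (forall g, g \in gs -> bdr g x = 0) -> lead fs w x -> count id w = k.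
Proof.
elim: fs gs w x k => [|f fs IH] gs [|b w] x k //=.
  rewrite cats0 => df hx gx x0; have h0 := detects_homog0 df hx gx.
  by have := homog0P h0 x0 => /[dup]/hx <-; rewrite cards0.
rewrite -cat_rcons => df hx gx; case: b => [l|[h l]]; last first.
  by rewrite add0n; apply: (IH _ _ _ _ df hx _ l); apply: killed_rcons.
have := IH _ _ _ _ df (homog_bdr hx) (killed_bdr (f := f) gx) l.
case: k hx => [hx|k _ -> //]; by have := lead_neq0 l; rewrite homog_bd0.
Qed.

Lemma lead_count fs w x k : detects fs -> homog k x -> lead fs w x -> count id w = k.
Proof. by move=> df hx; apply: (@lead_count_gen [::]). Qed.

(** When one factor is differentiated the other is killed, so the Leibniz rule keeps a single term;
    at the end there remains a product of two nonzero scalars. *)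
Lemma lead_wedge_gen gs fs w1 w2 x y k l : detects (gs ++ fs) -> homog k x -> homog l y ->
  (forall g, g \in gs -> bdr g x = 0) -> (forall g, g \in gs -> bdr g y = 0) ->
  lead fs w1 x -> lead fs w2 y -> all (fun p => ~~ (p.1 && p.2)) (zip w1 w2) ->
  wedge x y <> 0.
Proof.
elim: fs gs w1 w2 x y k l => [|f fs IH] gs [|b1 w1] [|b2 w2] x y k l //=.
  rewrite cats0 => df hx hy gx gy x0 y0 _ /(congr1 (fun z : chain => z set0)).
  rewrite wedge0 ffunE; apply/eqP; rewrite mulf_neq0 // homog0P //.
    exact: detects_homog0 df hx gx.
  exact: detects_homog0 df hy gy.
rewrite -cat_rcons => df hx hy gx gy.
have bdw := bdr_wedge f y hx.
case: b1; case: b2 => //=.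
- move=> l1 [h2 l2] dj w0; apply: (IH _ _ _ _ _ _ _ df (homog_bdr hx) hy _ _ l1 l2 dj).
  + exact: killed_bdr.
  + exact: killed_rcons.
  move: bdw; rewrite w0 bdr0 h2 => /esym; rewrite -(scale0r (0 : chain)) wedgeZr.
  by rewrite !scale0r scaler0 addr0.
- move=> [h1 l1] l2 dj w0; apply: (IH _ _ _ _ _ _ _ df hx (homog_bdr hy) _ _ l1 l2 dj).
  + exact: killed_rcons.
  + exact: killed_bdr.
  move: bdw; rewrite w0 bdr0 h1 => /esym; rewrite -(scale0r (0 : chain)) wedgeZl.
  by rewrite !scale0r add0r => /eqP; rewrite scaler_eq0 signr_eq0 => /eqP.
move=> [h1 l1] [h2 l2] dj; apply: (IH _ _ _ _ _ _ _ df hx hy _ _ l1 l2 dj); exact: killed_rcons.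
Qed.

Lemma lead_wedge fs w1 w2 x y k l : detects fs -> homog k x -> homog l y ->
  lead fs w1 x -> lead fs w2 y -> all (fun p => ~~ (p.1 && p.2)) (zip w1 w2) ->
  wedge x y <> 0.
Proof. by move=> df hx hy; apply: (@lead_wedge_gen [::] _ _ _ _ _ _ _ df hx hy). Qed.

(** Pointwise comparison of words of equal length, that is inclusion of monomials rather than the
    subsequence order. *)
Fixpoint subword w' w := match w', w with
  | b' :: w1', b :: w1 => (b' ==> b) && subword w1' w1
  | [::], [::] => true | _, _ => false end.

Lemma subword_count w w' : subword w' w -> (count id w' <= count id w)%N.
Proof.
elim: w w' => [|[] w IH] [|[] w'] //=; rewrite ?add0n ?add1n ?ltnS => /IH // h.
exact: leqW.
Qed.

Lemma lead_subword fs w w' x : subword w' w -> lead fs w x ->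
  exists2 gs, size gs = (count id w - count id w')%N & lead fs w' (bdl gs x).
Proof.
elim: fs w w' x => [|f fs IH] [|b w] [|b' w'] x //=.
  by move=> _ x0; exists [::].
case: b => [|] /=; last first.
  case: b' => //= sw [h l]; have [gs sz l'] := IH _ _ _ sw l.
  by exists gs; rewrite ?add0n // bdr_bdl h bdl0 scaler0.
move=> /andP[_ sw] l; have [gs sz l'] := IH _ _ _ sw l.
have cw := subword_count sw.
case: b'.
  exists gs; first by rewrite sz !add1n subSS.
  by rewrite bdr_bdl; apply: lead_sign.
exists (rcons gs f); first by rewrite size_rcons sz add1n add0n subSn.
rewrite bdl_rcons; split=> //; by rewrite bdr_bdl bdr_sq bdl0 scaler0.
Qed.

Lemma lead_ones fs1 fs2 w x y : x = bdl fs1 y ->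
  lead (fs1 ++ fs2) (nseq (size fs1) false ++ w) x -> lead (fs1 ++ fs2) (nseq (size fs1) true ++ w) y.
Proof.
move=> e; have {e} : exists n, x = (-1) ^+ n *: bdl fs1 y by exists 0%N; rewrite scale1r.
elim: fs1 x y => [|f fs1 IH] x y /= [n e].
  by move=> l; have := lead_sign n l; rewrite e scalerA -exprD addnn -signr_odd odd_double scale1r.
move=> [_]; apply: IH; exists (n + size fs1)%N; rewrite e bdr_bdl.
by rewrite scalerA exprD.
Qed.

Definition bdrV f : 'End(chain) := linfun (bdr f).
Lemma bdrVE f x : bdrV f x = bdr f x. Proof. by rewrite lfunE. Qed.

(** Words beginning with true come from the image of [bdrV f], the others from its kernel; rank and
    nullity then give the count in [size_words]. *)
Fixpoint words fs W : seq (seq bool) :=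
  if fs is f :: fs' then
    map (cons true) (words fs' (bdrV f @: W)%VS) ++ map (cons false) (words fs' (W :&: lker (bdrV f))%VS)
  else if W == 0%VS then [::] else [:: [::]].

Lemma mem_words fs W w : reflect (exists2 x, x \in W & lead fs w x) (w \in words fs W).
Proof.
elim: fs W w => [|f fs IH] W w /=.
  case: eqVneq => [->|W0].
    apply: (iffP idP) => // -[x]; rewrite memv0 => /eqP -> /=; by case: w.
  rewrite inE; case: w => [|b w] /=; last by apply: (iffP idP) => // -[].
  by apply: (iffP idP) => // _; exists (vpick W); rewrite ?memv_pick //; apply/eqP; rewrite vpick0.
rewrite mem_cat; apply: (iffP orP) => [[]/mapP[w']|[x xW]].
- move=> /IH[_ /memv_imgP[x xW ->] l] ->; exists x => //=; by rewrite -bdrVE.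
- move=> /IH[x]; rewrite memv_cap memv_ker => /andP[xW /eqP h] l ->.
  by exists x => //=; rewrite -bdrVE.
case: w => [|[] w] //= => [l|[h l]]; [left|right]; apply/mapP; exists w => //; apply/IH.
  by exists (bdr f x); rewrite // -bdrVE memv_img.
by exists x; rewrite // memv_cap xW memv_ker bdrVE h eqxx.
Qed.

Lemma words_uniq fs W : uniq (words fs W).
Proof.
elim: fs W => [|f fs IH] W /=; first by case: ifP.
rewrite cat_uniq !map_inj_uniq ?IH ?andbT /=; try by move=> ? ? [].
by apply/hasPn => _ /mapP[w _ ->]; apply/negP => /mapP[].
Qed.

Lemma size_words_gen gs fs W k : detects (gs ++ fs) -> (forall x, x \in W -> homog k x) ->
  (forall x g, x \in W -> g \in gs -> bdr g x = 0) -> size (words fs W) = \dim W.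
Proof.
elim: fs gs W k => [|f fs IH] gs W k /=.
  rewrite cats0 => df hW gW; case: eqVneq => [->|W0]; first by rewrite dimv0.
  apply/eqP; rewrite eqn_leq /= lt0n dimv_eq0 W0 /=.
  pose e0 : chain := [ffun A => (A == set0)%:R].
  apply: leq_trans (_ : \dim <[e0]> <= 1)%N; last by rewrite dim_vline leq_b1.
  apply/dimvS/subvP=> x xW; apply/vlineP; exists (x set0); apply/ffunP=> A.
  rewrite !ffunE; have [->|A0] := eqVneq A set0; first by rewrite /GRing.scale /= mulr1.
  rewrite scaler0; apply/eqP/negPn/negP=> xA.
  have /eqP := detects_homog0 df (hW _ xW) (fun g => gW x g xW) xA.
  by rewrite cards_eq0 (negPf A0).
rewrite -cat_rcons => df hW gW; rewrite size_cat !size_map.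
rewrite (IH (rcons gs f) _ k.-1 df); first last.
- move=> _ g /memv_imgP[x xW ->]; rewrite bdrVE; apply: killed_bdr => g'; exact: gW.
- by move=> _ /memv_imgP[x xW ->]; rewrite bdrVE; apply: homog_bdr; apply: hW.
rewrite (IH (rcons gs f) _ k df); first by rewrite addnC limg_ker_dim.
  by move=> x; rewrite memv_cap => /andP[/hW].
move=> x g; rewrite memv_cap memv_ker bdrVE => /andP[xW /eqP h].
by apply: killed_rcons => // g'; apply: gW.
Qed.

Lemma size_words fs W k : detects fs -> (forall x, x \in W -> homog k x) ->
  size (words fs W) = \dim W.
Proof. by move=> df hW; apply: (@size_words_gen [::] _ _ _ df hW). Qed.

Definition face (A : {set V}) : chain := [ffun B => (B == A)%:R].
Definition span_of X : {vspace chain} := <<[seq face A | A <- enum X]>>%VS.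

Lemma span_ofP X x : reflect (forall A, x A != 0 -> A \in X) (x \in span_of X).
Proof.
apply: (iffP idP) => [/coord_span -> A|h].
  rewrite sum_ffunE => h; apply: contraNT h => AX.
  rewrite big1 // => i _; rewrite !ffunE.
  have : (map_tuple [eta face] (enum_tuple X))`_i \in [seq face A0 | A0 <- enum X] by rewrite mem_nth // size_map -cardE.
  case/mapP => B; rewrite mem_enum => BX ->; rewrite ffunE.
  by case: eqVneq AX => [->|_ _]; rewrite ?BX // scaler0.
have -> : x = \sum_(A in X) x A *: face A.
  apply/ffunP=> A; rewrite sum_ffunE; have [AX|AX] := boolP (A \in X).
    rewrite (bigD1 A) //= big1 ?addr0.
      by rewrite !ffunE eqxx /GRing.scale /= mulr1.
    by move=> B /andP[_ BA]; rewrite !ffunE eq_sym (negPf BA) scaler0.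
  rewrite big1; first by apply/eqP/negPn/negP => /h; rewrite (negPf AX).
  by move=> B BX; rewrite !ffunE; case: eqVneq BX AX => [->->|]; rewrite // scaler0.
apply: memv_suml => A AX; apply/memvZ/memv_span/mapP; by exists A; rewrite ?mem_enum.
Qed.

Lemma dim_span_of X : \dim (span_of X) = #|X|.
Proof.
rewrite /span_of (_ : #|X| = size [seq face A | A <- enum X]); last by rewrite size_map -cardE.
apply/eqP; rewrite -/(free _); apply/freeP => a a0 i.
move/(congr1 (fun x : chain => x (nth set0 (enum X) i))): a0; rewrite sum_ffunE ffunE.
have sz (j : 'I_#|X|) : (j < size (enum X))%N by rewrite -cardE.
rewrite (bigD1 i) //= big1 ?addr0 => [|j ji].
  rewrite !ffunE (nth_map set0) //= ffunE eqxx /GRing.scale /= mulr1 //.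
rewrite !ffunE (nth_map set0) // ffunE nth_uniq ?enum_uniq // eq_sym val_eqE (negPf ji) scaler0 //.
Qed.
End Leads.

(** * Generic values of one parameter *)

Section NearZero.
Local Open Scope ring_scope.
Variables (K : fieldType) (e : nat -> K) (e_inj : injective e).
Implicit Types (P Q : K -> Prop) (q : {poly K}) (F G : K -> K).

Lemma poly_nonroot q : q != 0 -> exists t, q.[t] != 0.
Proof.
move=> q0; case: (boolP (all (root q) (map e (iota 0 (size q))))) => [h|/allPn[t _ ht]]; last by exists t.
have := max_poly_roots q0 h; rewrite map_inj_uniq ?iota_uniq // size_map size_iota.
by rewrite ltnn => /(_ isT).
Qed.

(** Zariski neighbourhoods of 0 on the line: they are stable under finite intersection and contain a
    nonzero scalar since [K] is infinite. *)
Definition near0 P := exists2 q : {poly K}, q.[0] != 0 & forall t, q.[t] != 0 -> P t.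

Lemma near0_ex P : near0 P -> exists2 t, t != 0 & P t.
Proof.
case=> q q0 h; have [|t] := @poly_nonroot ('X * q).
  by rewrite mulf_neq0 ?polyX_eq0 //; apply: contraNneq q0 => ->; rewrite horner0.
by rewrite hornerM hornerX mulf_eq0 negb_or => /andP[t0 /h]; exists t.
Qed.

Lemma near0_imp P Q : (forall t, P t -> Q t) -> near0 P -> near0 Q.
Proof. by move=> h [q q0 hq]; exists q => // t /hq /h. Qed.

Lemma near0T P : (forall t, P t) -> near0 P.
Proof. by move=> h; exists 1 => //; rewrite hornerC oner_eq0. Qed.

Lemma near0_and P Q : near0 P -> near0 Q -> near0 (fun t => P t /\ Q t).
Proof.
move=> [p p0 hp] [q q0 hq]; exists (p * q); first by rewrite hornerM mulf_neq0.
by move=> t; rewrite hornerM mulf_eq0 negb_or => /andP[/hp ? /hq].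
Qed.

Lemma near0_all (T : eqType) (s : seq T) (P : T -> K -> Prop) :
  (forall i, i \in s -> near0 (P i)) -> near0 (fun t => forall i, i \in s -> P i t).
Proof.
elim: s => [|a s IH] h; first exact: near0T.
have ha := h a (mem_head _ _).
have {}IH := IH (fun i si => h i (mem_behead (s := a :: s) si)).
apply: near0_imp (near0_and ha IH) => t [h1 h2] i.
by rewrite inE => /orP[/eqP->|/h2].
Qed.

Definition polyfun F := exists q : {poly K}, forall t, F t = q.[t].

Lemma polyfun_near0 F : polyfun F -> F 0 != 0 -> near0 (fun t => F t != 0).
Proof. by case=> q hq; rewrite hq => h; exists q => // t; rewrite hq. Qed.

Lemma polyfunC a : polyfun (fun=> a).
Proof. by exists a%:P => t; rewrite hornerC. Qed.
Lemma polyfunX : polyfun id.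
Proof. by exists 'X => t; rewrite hornerX. Qed.
Lemma polyfunD F G : polyfun F -> polyfun G -> polyfun (fun t => F t + G t).
Proof. by move=> [p hp] [q hq]; exists (p + q) => t; rewrite hornerD hp hq. Qed.
Lemma polyfunM F G : polyfun F -> polyfun G -> polyfun (fun t => F t * G t).
Proof. by move=> [p hp] [q hq]; exists (p * q) => t; rewrite hornerM hp hq. Qed.
Lemma polyfun_sum (I : Type) (r : seq I) (P : pred I) (F : I -> K -> K) :
  (forall i, polyfun (F i)) -> polyfun (fun t => \sum_(i <- r | P i) F i t).
Proof.
move=> h; elim: r => [|i r IH]; first by exists 0 => t; rewrite big_nil horner0.
have [p hp] := IH; have [q hq] := h i.
exists (if P i then q + p else p) => t; rewrite big_cons.
by case: (P i); rewrite ?hornerD -hp -?hq.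
Qed.
Lemma polyfun_prod (I : Type) (r : seq I) (P : pred I) (F : I -> K -> K) :
  (forall i, polyfun (F i)) -> polyfun (fun t => \prod_(i <- r | P i) F i t).
Proof.
move=> h; elim: r => [|i r IH]; first by exists 1 => t; rewrite big_nil hornerC.
have [p hp] := IH; have [q hq] := h i.
exists (if P i then q * p else p) => t; rewrite big_cons.
by case: (P i); rewrite ?hornerM -hp -?hq.
Qed.
Lemma polyfun_det n (M : K -> 'M[K]_n) :
  (forall i j, polyfun (fun t => M t i j)) -> polyfun (fun t => \det (M t)).
Proof.
move=> h; apply: polyfun_sum => s; apply: polyfunM; first exact: polyfunC.
by apply: polyfun_prod => i; apply: h.
Qed.
End NearZero.

(** * Lexicographic order on words *)

Section Code.
Local Open Scope ring_scope.
Implicit Types (u w : seq bool).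

(* The larger the code, the earlier the word in the lexicographic order in which true comes first. *)
Fixpoint code w : nat := if w is b :: w' then (b * 2 ^ size w' + code w')%N else 0%N.

Lemma code_lt w : (code w < 2 ^ size w)%N.
Proof.
elim: w => //= b w IH; rewrite expnS mul2n -addnn -addnS leq_add //.
by case: b; rewrite ?mul1n ?mul0n.
Qed.

Lemma code_inj u w : size u = size w -> code u = code w -> u = w.
Proof.
elim: u w => [|b u IH] [|c w] //= [sz].
have := code_lt u; have := code_lt w; rewrite -sz.
case: b; case: c; rewrite ?mul1n ?mul0n ?add0n // => lw lu h.
- by rewrite (IH w sz) //; apply/eqP; rewrite -(eqn_add2l (2 ^ size u)) h.
- by move: lw; rewrite -h ltnNge leq_addr.
- by move: lu; rewrite h ltnNge leq_addr.
by rewrite (IH w sz).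
Qed.
End Code.

(** * Semicontinuity of leading words *)

Section Generic.
Local Open Scope ring_scope.
Variables (K : fieldType) (V : finType).
Local Notation chain := {ffun {set V} -> K^o}.
Local Notation functional := {ffun V -> K^o}.
Implicit Types (A B C U s : {set V}) (v : V) (x y z : chain) (f g h : functional).
Implicit Types (X Y Z : {set {set V}}) (fs gs : seq functional) (u w : seq bool) (W : {vspace chain}).
Implicit Types (Gs : seq (K -> functional)).

Definition pfunctional (G : K -> functional) := forall v, polyfun (fun t => G t v).
Definition all_poly Gs := foldr (fun G P => pfunctional G /\ P) True Gs.
Definition at_ Gs t : seq functional := [seq G t | G <- Gs].

Lemma near0_good U Gs : all_poly Gs -> good U (at_ Gs 0) ->
  near0 (fun t => good U (at_ Gs t)).
Proof.
have [n] := ubnP (size Gs); elim: n Gs U => // n IH [|G Gs] U szn pG gU.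
  by apply: near0T => t; left.
have [pG0 {}pG] := pG.
pose Gs' v := [seq (fun t => pivot (G t) v (H t)) | H <- Gs].
have Gs'E v t : at_ (Gs' v) t = map (pivot (G t) v) (at_ Gs t) by rewrite /at_ -!map_comp.
have : near0 (fun t => forall v, v \in enum U -> G t v != 0 /\ good (U :\ v) (at_ (Gs' v) t)).
  apply: near0_all => v; rewrite mem_enum => vU.
  have [Gv gv] := good_consP gU vU.
  apply: near0_and; first exact: polyfun_near0.
  apply: IH; rewrite ?size_map // ?Gs'E //.
  rewrite /Gs'; elim: (Gs) pG => //= H Hs IHs [pH /IHs h]; split=> // w.
  have [q hq] := polyfunD (polyfunM (pG0 v) (pH w)) (polyfunM (polyfunC (-1)) (polyfunM (pH v) (pG0 w))).
  by exists q => t; rewrite -hq !ffunE mulN1r.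
apply: near0_imp => t h; right=> v vU; have [] := h v; rewrite ?mem_enum //.
by rewrite Gs'E.
Qed.

(** Coefficient of [x] at the monomial [w] in the dual basis, up to sign; unlike [lead], it depends
    polynomially on the functionals. *)
Fixpoint coordw fs w x : K :=
  match fs, w with
  | f :: fs', b :: w' => coordw fs' w' (if b then bdr f x else x)
  | _, _ => x set0
  end.

Lemma coordw0 fs w : coordw fs w 0 = 0.
Proof.
by elim: fs w => [|f fs IH] [|b w] /=; rewrite ?ffunE // bdr0 if_same.
Qed.

Lemma coordwD fs w a b x y : coordw fs w (a *: x + b *: y) = a * coordw fs w x + b * coordw fs w y.
Proof.
elim: fs w x y => [|f fs IH] [|c w] x y /=; rewrite ?ffunE //.
by rewrite -IH; case: c => //; rewrite linearP linearZ.
Qed.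

Lemma coordw_sum fs w m (a : 'I_m -> K) (x : 'I_m -> chain) :
  coordw fs w (\sum_i a i *: x i) = \sum_i a i * coordw fs w (x i).
Proof.
elim/big_rec2: _ => [|i y1 y2 _ <-]; first exact: coordw0.
by have := coordwD fs w (a i) 1 (x i) y2; rewrite scale1r mul1r.
Qed.

Lemma coordw_polyfun Gs w (x : K -> chain) :
  all_poly Gs -> (forall A, polyfun (fun t => x t A)) ->
  polyfun (fun t => coordw (at_ Gs t) w (x t)).
Proof.
elim: Gs w x => [|G Gs IH] [|b w] x pG px /=; try exact: px.
have [pG0 {}pG] := pG.
apply: (IH w (fun t => if b then bdr (G t) (x t) else x t)) => // A.
case: b => //; have [q hq] : polyfun (fun t => \sum_(v | v \notin A) G t v * ((-1) ^+ ninv [set v] A * x t (v |: A))).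
  apply: polyfun_sum => v; apply: polyfunM; first exact: pG0.
  by apply: polyfunM; [apply: polyfunC | apply: px].
by exists q => t; rewrite -hq bdrE.
Qed.

(** Where the words first differ, [u] has true and [w] false, so the boundary that [coordw] applies
    there gives 0. *)
Lemma lead_coordw fs w u x : lead fs w x -> size u = size fs -> (code w < code u)%N ->
  coordw fs u x = 0.
Proof.
elim: fs w u x => [|f fs IH] [|b w] [|c u] x //= l [sz].
have szw : size w = size fs.
  by case: b l => [/lead_size|[_ /lead_size]].
have := code_lt u; have := code_lt w; rewrite sz szw.
case: b c l => [] [] /=; rewrite ?mul1n ?mul0n ?add0n.
- by move=> l _ _; rewrite ltn_add2l; apply: IH.
- by move=> _ _ lu lt; have := ltn_trans lt lu; rewrite ltnNge leq_addr.
- by move=> [-> _] _ _ _; apply: coordw0.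
by move=> [_ l] _ _; apply: IH.
Qed.

Lemma lead_coordw_neq0_gen gs fs w x k : detects (gs ++ fs) -> homog k x ->
  (forall g, g \in gs -> bdr g x = 0) -> lead fs w x -> coordw fs w x != 0.
Proof.
elim: fs gs w x k => [|f fs IH] gs [|b w] x k //=.
  rewrite cats0 => df hx gx x0; exact: homog0P (detects_homog0 df hx gx) x0.
rewrite -cat_rcons => df hx gx; case: b => [l|[h l]].
  by apply: (IH _ _ _ _ df (homog_bdr hx) _ l); apply: killed_bdr.
by apply: (IH _ _ _ _ df hx _ l); apply: killed_rcons.
Qed.

Lemma lead_coordw_neq0 fs w x k : detects fs -> homog k x -> lead fs w x -> coordw fs w x != 0.
Proof. by move=> df hx; apply: (@lead_coordw_neq0_gen [::] _ _ _ _ df hx). Qed.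

Definition rho c fs W := count (fun u => c <= code u)%N (words fs W).

Lemma words_size fs W w : w \in words fs W -> size w = size fs.
Proof. by move/mem_words => [x _ /lead_size]. Qed.

(* Lower semicontinuity of the number of leading words with code at least c. *)
Lemma near0_rho c Gs W k : all_poly Gs ->
  (forall x, x \in W -> homog k x) -> detects (at_ Gs 0) ->
  near0 (fun t => detects (at_ Gs t)) ->
  near0 (fun t => (rho c (at_ Gs 0) W <= rho c (at_ Gs t) W)%N).
Proof.
move=> pG hW d0 dt.
pose us := [seq u <- words (at_ Gs 0) W | (c <= code u)%N]; pose m := size us.
pose ui (i : 'I_m) := nth [::] us i.
have uiP i : (ui i \in words (at_ Gs 0) W) /\ (c <= code (ui i))%N.
  have : ui i \in us by apply: mem_nth.
  by rewrite mem_filter => /andP[].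
have ui_inj : injective ui.
  move=> i j /eqP; rewrite nth_uniq ?filter_uniq ?words_uniq // => /eqP; exact: val_inj.
have uisz i : size (ui i) = size Gs by have [/words_size] := uiP i; rewrite size_map.
have /fin_all_exists[x hx] i : exists x, x \in W /\ lead (at_ Gs 0) (ui i) x.
  by have [/mem_words[x xW l] _] := uiP i; exists x.
have comb a : \sum_i a i *: x i \in W.
  by apply: memv_suml => i _; apply: memvZ; have [] := hx i.
pose M t : 'M[K]_m := \matrix_(i, j) coordw (at_ Gs t) (ui j) (x i).
(* [M 0] is triangular in the order of codes: in a row relation, the column of the largest code with
   a nonzero coefficient has a single nonzero term. *)
have M0 : \det (M 0) != 0.
  rewrite -unitfE -[_ \is a _]/(M 0 \in unitmx) -row_free_unit; apply: inj_row_free => a aM.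
  apply/rowP=> i; rewrite mxE; apply/eqP/negPn/negP => ai.
  have [j aj jmax] := @arg_maxnP _ i (fun j => a 0 j != 0) (fun j => code (ui j)) ai.
  have /rowP/(_ j) := aM; rewrite !mxE (bigD1 j) //= big1 ?addr0 => [|l lj].
    rewrite mxE => /eqP; rewrite mulf_eq0 (negPf aj) /=; apply/negP.
    have [xW l] := hx j; exact: lead_coordw_neq0 d0 (hW _ xW) l.
  have [->|al] := eqVneq (a 0 l) 0; first by rewrite mul0r.
  rewrite mxE; have [_ hl] := hx l; rewrite (lead_coordw hl) ?mulr0 //.
    by rewrite uisz size_map.
  rewrite ltn_neqAle; apply/andP; split; last exact: jmax.
  apply: contra lj => /eqP /code_inj e.
  by apply/eqP/ui_inj/e; rewrite !uisz.
have pM : polyfun (fun t => \det (M t)).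
  apply: polyfun_det => i j.
  have [q hq] := coordw_polyfun (ui j) pG (fun A => polyfunC (x i A)).
  by exists q => t; rewrite mxE hq.
apply: near0_imp (near0_and (polyfun_near0 pM M0) dt) => t [Mt {}dt].
have MtK (a : 'I_m -> K) : (forall j, coordw (at_ Gs t) (ui j) (\sum_i a i *: x i) = 0) ->
    forall i, a i = 0.
  move=> h i; pose r : 'rV[K]_m := \row_i a i.
  have rM : r *m M t = 0.
    apply/rowP=> j; rewrite mxE [RHS]mxE -[RHS](h j) coordw_sum; apply: eq_bigr => i' _.
    by rewrite !mxE.
  have Mu : M t \in unitmx by rewrite unitmxE unitfE.
  have : r = 0 by rewrite -[r]mulmx1 -(mulmxV Mu) mulmxA rM mul0mx.
  by move/rowP/(_ i); rewrite !mxE.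
pose xs := [tuple x i | i < m]; pose W' := <<xs>>%VS.
have xsE (i : 'I_m) : xs`_i = x i by rewrite -tnth_nth tnth_mktuple.
have dW' : \dim W' = m.
  apply/eqP; rewrite -[X in _ == X](size_tuple xs) -/(free xs); apply/freeP => a a0.
  apply: MtK => j; rewrite -[X in coordw _ _ X]/(\sum_i a i *: x i).
  under eq_bigr do rewrite -xsE.
  by rewrite a0 coordw0.
have W'W z : z \in W' -> z \in W.
  move=> /coord_span ->; apply: memv_suml => i _; apply: memvZ; rewrite xsE.
  by have [] := hx i.
have szw : size (words (at_ Gs t) W') = m by rewrite (size_words dt (k := k)) // => z /W'W; apply: hW.
rewrite /rho -size_filter -/us -/m -szw -size_filter; apply: uniq_leq_size; first exact: words_uniq.
move=> w /mem_words[z zW' l]; rewrite mem_filter; apply/andP; split; last first.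
  by apply/mem_words; exists z => //; apply: W'W.
(* A leading word of code below [c] would make all coordinates of [z] at the [ui j] vanish, which
   invertibility of [M t] excludes. *)
rewrite leqNgt; apply/negP => cw; apply: (lead_neq0 l).
rewrite (coord_span zW') big1 // => i _.
rewrite (MtK (fun i => coord xs i z)) ?scale0r // => j.
have -> : \sum_i coord xs i z *: x i = z.
  by rewrite [RHS](coord_span zW'); apply: eq_bigr => i' _; rewrite xsE.
apply: lead_coordw l _ _; first by rewrite uisz size_map.
by apply: leq_trans cw _; have [] := uiP j.
Qed.

End Generic.

(** * Functionals with shifted families of leading words *)

Section GenericList.
Local Open Scope ring_scope.
Variables (K : fieldType) (V : finType) (e : nat -> K) (e_inj : injective e).
Local Notation chain := {ffun {set V} -> K^o}.
Local Notation functional := {ffun V -> K^o}.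
Implicit Types (A B C U s : {set V}) (v : V) (x y z : chain) (f g h : functional).
Implicit Types (X Y Z : {set {set V}}) (fs gs : seq functional) (u w : seq bool) (W : {vspace chain}).

Definition poly_functional (c b : V -> K) (p : {poly K}) : functional := [ffun v => b v * p.[c v]].

Lemma pivot_identity (bv bw a r q d : K) :
  bv * a * bw * (r + q * d) - bv * r * bw * a = bv * bw * a * d * q.
Proof. by ring. Qed.

(** Vandermonde by elimination: pivoting at [v] turns each polynomial into its divided difference at
    [c v], of degree one less; the factor [c v' - c v] moves into the weights [b], which are carried
    for that purpose. *)
Lemma good_poly c b U (ps : seq {poly K}) : injective c -> (forall v, v \in U -> b v != 0) ->
  (forall i, (i < size ps)%N -> size (nth 0 ps i) = i.+1) ->
  good U (map (poly_functional c b) ps).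
Proof.
move=> cI; have [n] := ubnP (size ps); elim: n ps U b => // n IH [|p ps] U b szn b0 hs /=.
  exact: good_nil.
apply: good_cons => v vU; have /eqP/size_poly1P[a a0 pE] := hs 0%N isT.
have pv v' : p.[c v'] = a by rewrite [p]pE hornerC.
split; first by rewrite ffunE pv mulf_neq0 // b0.
pose r i := nth 0 ps i; pose q i := (r i - (r i).[c v]%:P) %/ ('X - (c v)%:P).
have qE i : r i - (r i).[c v]%:P = q i * ('X - (c v)%:P).
  by apply/esym/divpK; rewrite dvdp_XsubCl rootE !hornerE subrr.
have -> : map (pivot (poly_functional c b p) v) (map (poly_functional c b) ps)
   = map (poly_functional c (fun v' => b v * b v' * a * (c v' - c v))) (mkseq q (size ps)).
  apply: (@eq_from_nth _ 0); rewrite !size_map ?size_iota // => i ip.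
  rewrite (nth_map (0 : functional)) ?size_map // (nth_map (0 : {poly K})) //.
  rewrite (nth_map (0 : {poly K})) ?size_mkseq // nth_mkseq //.
  apply/ffunP=> v'; rewrite !ffunE !pv -/(r i) /GRing.scale /=.
  have /(congr1 (fun s : {poly K} => s.[c v'])) := qE i; rewrite !hornerE => h.
  have -> : (r i).[c v'] = (r i).[c v] + (q i).[c v'] * (c v' - c v) by rewrite -h addrCA subrr addr0.
  exact: pivot_identity.
apply: IH; first by rewrite size_mkseq.
  move=> v'; rewrite !inE => /andP[v'v v'U].
  rewrite !mulf_neq0 ?b0 // subr_eq0; apply: contra v'v => /eqP /cI ->; exact: eqxx.
move=> i; rewrite size_mkseq => ip; rewrite nth_mkseq // size_divp ?polyXsubC_eq0 //.
rewrite size_XsubC subn1 /=; have := hs i.+1 ip; rewrite /= -/(r i) => sr.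
by rewrite size_polyDl ?size_polyN sr // (leq_ltn_trans (size_polyC_leq1 _)).
Qed.

Lemma good_exists : exists2 fs : seq functional, size fs = #|V| & good [set: V] fs.
Proof.
pose c (v : V) := e (enum_rank v).
have cI : injective c by move=> v v' /e_inj /val_inj /enum_rank_inj.
exists (map (poly_functional c (fun=> 1)) (mkseq (fun i => 'X^i) #|V|)).
  by rewrite size_map size_mkseq.
apply: good_poly cI _ _ => [v _|i]; first exact: oner_neq0.
by rewrite size_mkseq => ip; rewrite nth_mkseq // size_polyXn.
Qed.

Lemma good_detects fs : (#|V| <= size fs)%N -> good [set: V] fs -> detects fs.
Proof.
move=> sz gfs x k hx; apply: (good_full gfs _ _ hx); first by rewrite cardsT.
by move=> A _; apply: subsetT.
Qed.

Definition swapat i w := take i w ++ [:: true; false] ++ drop i.+2 w.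

Definition swap_closed (S : {pred seq bool}) := forall w i, w \in S -> (i.+1 < size w)%N ->
  nth false w i = false -> nth false w i.+1 -> swapat i w \in S.

Lemma swapat_cat w i : (i.+1 < size w)%N -> nth false w i = false -> nth false w i.+1 ->
  w = take i w ++ [:: false; true] ++ drop i.+2 w.
Proof.
move=> iw wi wi1; rewrite -{1}(cat_take_drop i w) (drop_nth false) 1?ltnW // wi.
by rewrite (drop_nth false) // wi1.
Qed.

(** On a chain killed by [g] the boundary at [g + t *: h] is [t] times that at [h], and a second [h]
    kills the result. *)
Lemma lead_swap gs g h hs u w x t : size u = size gs -> t != 0 ->
  lead (gs ++ [:: g, h & hs]) (u ++ [:: false, true & w]) x ->
  lead (gs ++ [:: g + t *: h, h & hs]) (u ++ [:: true, false & w]) x.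
Proof.
move=> + t0; elim: gs u x => [|f gs IH] [|b u] x //=.
  move=> _ [g0 l]; rewrite bdrDf bdrZf g0 add0r bdrZ bdr_sq scaler0; split=> //.
  exact: leadZ.
by move=> [sz]; case: b => [|[h0 l]]; [apply: IH | split=> //; apply: IH].
Qed.

Lemma sum_nat_lt (I : finType) (F G : I -> nat) i : (forall j, F j <= G j)%N -> (F i < G i)%N ->
  (\sum_j F j < \sum_j G j)%N.
Proof.
move=> le lt; rewrite (bigD1 i) //= [X in (_ < X)%N](bigD1 i) //=.
by rewrite -addSn leq_add // leq_sum.
Qed.

(** For words of length [#|V|] this is the sum of [code u + 1] over the leading words. The
    thresholds run to [2 ^ #|V|] included, so that [(code u).+1] is always one of them. *)
Definition potential fs W := (\sum_(c < (2 ^ #|V|).+1) rho c fs W)%N.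

Lemma rho_step fs W w : size fs = #|V| -> size w = #|V| ->
  rho (code w) fs W = ((w \in words fs W) + rho (code w).+1 fs W)%N.
Proof.
move=> sfs sw; rewrite /rho -(count_uniq_mem _ (words_uniq _ _)).
rewrite -count_predUI [X in (_ + X)%N](_ : _ = 0)%N ?addn0; last first.
  rewrite (@eq_count _ _ pred0) ?count_pred0 // => u /=.
  by apply/negbTE/negP => /andP[/eqP ->]; rewrite ltnn.
apply: eq_in_count => u /words_size su /=; rewrite leq_eqVlt eq_sym; congr (_ || _).
by apply/eqP/eqP => [/code_inj ->|->] //; rewrite su sfs sw.
Qed.

(* Replacing g by g + t h, where g and h are the functionals at the positions i and i+1, makes
   swapat i w a leading word for every t != 0, and for generic t no count rho decreases. *)
Lemma improve fs X Y p q Z w i : size fs = #|V| -> good [set: V] fs ->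
  (forall A, A \in X -> #|A| = p) -> (forall A, A \in Y -> #|A| = q) ->
  Z = X \/ Z = Y -> w \in words fs (span_of K Z) -> (i.+1 < size w)%N ->
  nth false w i = false -> nth false w i.+1 -> swapat i w \notin words fs (span_of K Z) ->
  exists fs', [/\ size fs' = #|V|, good [set: V] fs' &
    (potential fs (span_of K X) + potential fs (span_of K Y) <
     potential fs' (span_of K X) + potential fs' (span_of K Y))%N].
Proof.
move=> sfs gfs hX hY hZ wW iw wi wi1 sw.
have hom (S : {set {set V}}) k : (forall A, A \in S -> #|A| = k) -> forall x, x \in span_of K S -> homog k x.
  by move=> hS x /span_ofP xS A /xS /hS.
have szw := words_size wW.
have ifs : (i.+1 < size fs)%N by rewrite -szw.
pose gs := take i fs; pose g := nth 0 fs i; pose h := nth 0 fs i.+1; pose hs := drop i.+2 fs.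
have fsE : fs = gs ++ [:: g, h & hs].
  by rewrite -{1}(cat_take_drop i fs) (drop_nth 0) 1?ltnW // (drop_nth 0).
pose Gs : seq (K -> functional) := map (fun f => fun=> f) gs ++
  [:: (fun t => g + t *: h), (fun=> h) & map (fun f => fun=> f) hs].
have atE t : at_ Gs t = gs ++ [:: g + t *: h, h & hs].
  by rewrite /at_ map_cat /= -!map_comp !map_id_in.
have at0 : at_ Gs 0 = fs by rewrite atE scale0r addr0 -fsE.
have pG : all_poly Gs.
  have pc (f : functional) : pfunctional (fun=> f) by move=> v; apply: polyfunC.
  have pcat (r : seq functional) (s : seq (K -> functional)) : all_poly s -> all_poly (map (fun f => fun=> f) r ++ s).
    by move=> hs'; elim: r => //= f r IHr; exact: (conj (pc f) IHr).
  have pcs (r : seq functional) : all_poly (map (fun f => fun=> f) r).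
    by rewrite -[map _ _]cats0; apply: pcat.
  apply: pcat; refine (conj _ (conj (pc h) (pcs hs))).
  move=> v; have [r hr] := polyfunD (polyfunC (g v)) (polyfunM (@polyfunX K) (polyfunC (h v))).
  by exists r => t; rewrite !ffunE -hr.
have sG t : size (at_ Gs t) = #|V|.
  by rewrite atE -sfs fsE !size_cat /=.
have ng : near0 (fun t => good [set: V] (at_ Gs t)) by apply: near0_good; rewrite ?at0.
have nd : near0 (fun t => detects (at_ Gs t)).
  by apply: near0_imp ng => t; apply: good_detects; rewrite sG.
have d0 : detects (at_ Gs 0) by rewrite at0; apply: good_detects; rewrite ?sfs.
have nr (S : {set {set V}}) k : (forall A, A \in S -> #|A| = k) ->
    near0 (fun t => forall c, c \in iota 0 (2 ^ #|V|).+1 ->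
       (rho c fs (span_of K S) <= rho c (at_ Gs t) (span_of K S))%N).
  move=> hS; apply: near0_all => c _; have := near0_rho c pG (hom S k hS) d0 nd.
  by rewrite at0.
have [t t0 [gt [tX tY]]] := near0_ex e_inj (near0_and ng (near0_and (nr _ _ hX) (nr _ _ hY))).
have leS (S : {set {set V}}) (c : 'I_(2 ^ #|V|).+1) : S = X \/ S = Y -> (rho c fs (span_of K S) <= rho c (at_ Gs t) (span_of K S))%N.
  by case=> ->; [apply: tX | apply: tY]; rewrite mem_iota ltn_ord.
have leP (S : {set {set V}}) : S = X \/ S = Y -> (potential fs (span_of K S) <= potential (at_ Gs t) (span_of K S))%N.
  by move=> hS; apply: leq_sum => c _; apply: leS.
exists (at_ Gs t); split=> //.
suff ltZ : (potential fs (span_of K Z) < potential (at_ Gs t) (span_of K Z))%N.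
  case: hZ ltZ => -> ltZ; first by rewrite -addSn leq_add // leP //; right.
  by rewrite -addnS leq_add // leP //; left.
have swt : swapat i w \in words (at_ Gs t) (span_of K Z).
  have [x xZ l] := mem_words _ _ _ wW; rewrite {1}(swapat_cat iw wi wi1) fsE in l.
  apply/mem_words; exists x => //; rewrite atE; apply: lead_swap => //.
  by rewrite !size_takel // -?szw ltnW // ltnW.
have ssw : size (swapat i w) = #|V| by rewrite (words_size swt) sG.
pose c := code (swapat i w).
have cV : (c < 2 ^ #|V|)%N by rewrite -ssw code_lt.
(* [swapat i w] is counted at [c] for the new sequence only; if the count at [c] did not grow, the
   one at [c.+1] would drop. *)
have [lt|ge] := ltnP (rho c fs (span_of K Z)) (rho c (at_ Gs t) (span_of K Z)).
  by apply: (@sum_nat_lt _ _ _ (inord c)) => [j|]; [apply: leS | rewrite inordK // ltnS ltnW].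
have := leS Z (inord c.+1) hZ; rewrite inordK // leqNgt => /negP[].
by move: ge; rewrite !rho_step // swt (negPf sw) add0n add1n.
Qed.

Definition swap_closedb (S : seq (seq bool)) :=
  all (fun w => all (fun i => (~~ nth false w i && nth false w i.+1) ==> (swapat i w \in S))
                    (iota 0 (size w).-1)) S.

Lemma swap_closedP S : swap_closedb S -> swap_closed (mem S).
Proof.
move=> /allP h w i wS iw wi wi1; have /allP/(_ i) := h w wS.
by rewrite mem_iota add0n /= -ltnS prednK ?(leq_trans _ iw) // wi wi1 => /(_ isT).
Qed.

Lemma swap_closedPn S : ~~ swap_closedb S -> exists w i, [/\ w \in S, (i.+1 < size w)%N,
  nth false w i = false, nth false w i.+1 & swapat i w \notin S].
Proof.
move=> /allPn[w wS /allPn[i]]; rewrite mem_iota add0n /= => iw.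
rewrite negb_imply => /andP[/andP[/negbTE wi wi1] sw]; exists w, i; split=> //.
by case: (size w) iw.
Qed.

(* A sequence of functionals of maximal potential plays the role of a generic basis in exterior
   algebraic shifting. *)
Theorem generic_exists X Y p q :
  (forall A, A \in X -> #|A| = p) -> (forall A, A \in Y -> #|A| = q) ->
  exists fs, [/\ size fs = #|V|, good [set: V] fs,
    swap_closed (mem (words fs (span_of K X))) & swap_closed (mem (words fs (span_of K Y)))].
Proof.
move=> hX hY; have [fs0 sz0 g0] := good_exists.
pose Phi fs := (potential fs (span_of K X) + potential fs (span_of K Y))%N.
pose B := ((2 ^ #|V|).+1 * #|X| + (2 ^ #|V|).+1 * #|Y|)%N.
have bnd fs : size fs = #|V| -> good [set: V] fs -> (Phi fs <= B)%N.
  move=> sfs gfs; have df : detects fs by apply: good_detects; rewrite ?sfs.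
  have bS (S : {set {set V}}) k : (forall A, A \in S -> #|A| = k) -> (potential fs (span_of K S) <= (2 ^ #|V|).+1 * #|S|)%N.
    move=> hS; rewrite -{1}(card_ord (2 ^ #|V|).+1) -sum_nat_const; apply: leq_sum => c _.
    rewrite -(dim_span_of K S) -(size_words df (k := k)) ?count_size //.
    by move=> x /span_ofP xS A /xS /hS.
  by rewrite leq_add //; [apply: bS hX | apply: bS hY].
have [n] := ubnP (B - Phi fs0); elim: n fs0 sz0 g0 => // n IH fs sfs gfs; rewrite ltnS => len.
have step Z : Z = X \/ Z = Y -> ~~ swap_closedb (words fs (span_of K Z)) ->
    exists fs', [/\ size fs' = #|V|, good [set: V] fs',
    swap_closed (mem (words fs' (span_of K X))) & swap_closed (mem (words fs' (span_of K Y)))].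
  move=> hZ /swap_closedPn[w [i [wW iw wi wi1 sw]]].
  have [fs' [sfs' gfs' lt]] := improve sfs gfs hX hY hZ wW iw wi wi1 sw.
  apply: (IH fs' sfs' gfs'); apply: leq_trans len; apply: ltn_sub2l => //.
  by apply: leq_trans lt _; apply: bnd.
case: (boolP (swap_closedb (words fs (span_of K X)))) => [/swap_closedP cX|]; last by apply: step; left.
case: (boolP (swap_closedb (words fs (span_of K Y)))) => [/swap_closedP cY|]; last by apply: step; right.
by exists fs.
Qed.
End GenericList.

(** * Ballot counts and reflection of words *)

Section Words.
Implicit Types (w a b : seq bool) (P Q S : seq (seq bool)) (i l n p q : nat).

Definition cnt l w := count id (take l w).

Lemma cnt_le l w : cnt l w <= l.
Proof.
by rewrite /cnt (leq_trans (count_size _ _)) // size_take; case: ltnP.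
Qed.

Lemma cnt_nth l w : cnt l.+1 w = cnt l w + nth false w l.
Proof.
rewrite /cnt; case: (ltnP l (size w)) => lw; last by rewrite nth_default // !take_oversize ?addn0 // ltnW.
by rewrite (take_nth false) // -cats1 count_cat /= addn0.
Qed.

Lemma cnt_count l w : cnt l w <= count id w.
Proof. by rewrite -{2}(cat_take_drop l w) count_cat leq_addr. Qed.

Lemma cnt_size l w : size w <= l -> cnt l w = count id w.
Proof. by move=> h; rewrite /cnt take_oversize. Qed.

Lemma cnt_swapat l i w : i.+1 < size w -> nth false w i = false -> nth false w i.+1 ->
  cnt l (swapat i w) = cnt l w + (l == i.+1).
Proof.
move=> iw wi wi1; rewrite [in RHS](swapat_cat iw wi wi1) /swapat /cnt.
have sz : size (take i w) = i by rewrite size_takel // ltnW // ltnW.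
move: (take i w) (drop _ w) sz => u z <- {i w iw wi wi1}.
elim: u l => [|c u IH] [|l] //=; last by rewrite IH addnA eqSS.
case: l => [|l] //=; by rewrite !add0n ?addn0.
Qed.

Definition meet a b := exists i, nth false a i && nth false b i.

(* A pair of words violating the conclusion could be pushed apart, one shift at a time,
   until the two words are disjoint. *)
Lemma cross_ballot n P Q : (forall a, a \in P -> size a = n) -> (forall b, b \in Q -> size b = n) ->
  swap_closed (mem P) -> swap_closed (mem Q) ->
  (forall a b, a \in P -> b \in Q -> meet a b) ->
  forall a b, a \in P -> b \in Q -> exists2 l, l <= n & l < cnt l a + cnt l b.
Proof.
move=> sP sQ cP cQ cr a b.
pose mu a b := \sum_(l < n.+1) (cnt l a + cnt l b).
have mu_le a' b' : mu a' b' <= n.+1 * (n + n).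
  rewrite -{1}(card_ord n.+1) -sum_nat_const; apply: leq_sum => l _.
  by apply: leq_add; apply: leq_trans (cnt_le _ _) _; rewrite -ltnS.
have mu_lt a1 b1 a2 b2 j : j.+1 <= n ->
    (forall l, cnt l a2 + cnt l b2 = cnt l a1 + cnt l b1 + (l == j.+1)) ->
    n.+1 * (n + n) - mu a2 b2 < n.+1 * (n + n) - mu a1 b1.
  move=> jn h; suff lt : mu a1 b1 < mu a2 b2 by apply: ltn_sub2l => //; apply: leq_trans lt _.
  apply: (@sum_nat_lt _ _ _ (Ordinal (jn : j.+1 < n.+1))) => [l|]; rewrite h ?leq_addr //=.
  by rewrite eqxx addn1.
have [m] := ubnP (n.+1 * (n + n) - mu a b); elim: m a b => // m IH a b; rewrite ltnS => le aP bQ.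
case: (pickP (fun l : 'I_n.+1 => l < cnt l a + cnt l b)) => [l hl|no].
  by exists l => //; rewrite -ltnS.
have no' l : l <= n -> cnt l a + cnt l b <= l.
  by move=> ln; have := no (Ordinal (ln : l < n.+1)) => /= /negbT; rewrite -leqNgt.
have [c /andP[ac bc]] := cr a b aP bQ.
have cn : c < n by rewrite -(sP a aP) ltnNge; apply/negP => h; rewrite nth_default in ac.
have hc : cnt c a + cnt c b < c.
  by have := no' c.+1 cn; rewrite !cnt_nth ac bc; lia.
(* Going down from [c], the deficit forces a position [j] where both words have zeros, followed by a
   one. Moving that one to [j] keeps the counts within bounds, as neither word has a one at [j]. *)
have : exists2 j, j < c & [/\ nth false a j = false, nth false b j = false &
     nth false a j.+1 || nth false b j.+1].
  have hc1 : nth false a c || nth false b c by rewrite ac.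
  have hc' : cnt c a + cnt c b < c := hc.
  move: hc' hc1 {ac bc hc cn}; elim: c => // c IHc; rewrite !cnt_nth.
  case ac: (nth false a c); case bc: (nth false b c) => /= h h1.
  - have [||j jc hj] := IHc; rewrite ?ac //; first by lia.
    by exists j => //; apply: ltnW.
  - have [||j jc hj] := IHc; rewrite ?ac //; first by lia.
    by exists j => //; apply: ltnW.
  - have [||j jc hj] := IHc; rewrite ?bc ?orbT //; first by lia.
    by exists j => //; apply: ltnW.
  by exists c; rewrite // ac bc.
case=> j jc [aj bj /orP[j1|j1]].
  have ja : j.+1 < size a by rewrite (sP a aP); apply: leq_ltn_trans cn.
  have [|l ln] := IH (swapat j a) b _ (cP a j aP ja aj j1) bQ.
    apply: leq_trans le; apply: (mu_lt _ _ _ _ j); first exact: leq_trans jc (ltnW cn).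
    by move=> l; rewrite cnt_swapat // addnAC.
  rewrite cnt_swapat //; have := no' l ln; case: eqP => [e|]; last lia.
  by have := no' j (ltnW (leq_trans jc (ltnW cn))); rewrite e !cnt_nth aj bj; lia.
have jb : j.+1 < size b by rewrite (sQ b bQ); apply: leq_ltn_trans cn.
have [|l ln] := IH a (swapat j b) _ aP (cQ b j bQ jb bj j1).
  apply: leq_trans le; apply: (mu_lt _ _ _ _ j); first exact: leq_trans jc (ltnW cn).
  by move=> l; rewrite cnt_swapat // addnA.
rewrite cnt_swapat //; have := no' l ln; case: eqP => [e|]; last lia.
by have := no' j (ltnW (leq_trans jc (ltnW cn))); rewrite e !cnt_nth aj bj; lia.
Qed.

Definition reflect_word i w := map negb (take i w) ++ drop i w.

Lemma refl_inj i a b : reflect_word i a = reflect_word i b -> a = b.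
Proof.
have reflK w : reflect_word i (reflect_word i w) = w.
  case: (leqP i (size w)) => h.
    have st : size (map negb (take i w)) = i by rewrite size_map size_takel.
    rewrite /reflect_word take_cat drop_cat st ltnn subnn take0 drop0 cats0.
    by rewrite (mapK negbK) cat_take_drop.
  have h' := ltnW h; have hm : size (map negb w) <= i by rewrite size_map.
  rewrite /reflect_word (take_oversize h') (drop_oversize h') cats0.
  by rewrite (take_oversize hm) (drop_oversize hm) cats0 (mapK negbK).
by move=> e; rewrite -(reflK a) e reflK.
Qed.

Lemma cnt_refl_low l i w : l <= i -> i <= size w -> cnt l (reflect_word i w) + cnt l w = l.
Proof.
move=> li iw; rewrite /cnt /reflect_word take_cat size_map size_takel //.
have -> : (if l < i then take l (map negb (take i w)) else map negb (take i w) ++ take (l - i) (drop i w))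
   = map negb (take l w).
  case: (ltnP l i) => h; first by rewrite -map_take (take_takel _ (ltnW h)).
  have e : l = i by apply/eqP; rewrite eqn_leq li.
  by rewrite e subnn take0 cats0.
rewrite count_map addnC -[RHS](size_takel (leq_trans li iw)) -(count_predC id).
by congr (_ + _); apply: eq_count.
Qed.

Lemma cnt_refl_high l i w : i <= l -> i <= size w -> cnt l (reflect_word i w) + 2 * cnt i w = i + cnt l w.
Proof.
move=> il iw; have := cnt_refl_low (leqnn i) iw.
have h (u : seq bool) : cnt l u = cnt i u + cnt (l - i) (drop i u).
  by rewrite /cnt -count_cat -takeD subnKC.
rewrite (h (reflect_word i w)) (h w).
have -> : drop i (reflect_word i w) = drop i w.
  by rewrite /reflect_word drop_size_cat // size_map size_takel.
lia.
Qed.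

(* The injection P -> L \ Q complements a word of P up to its last crossing of the diagonal;
   the case e = 1 is that of a family together with its link at the apex, the case e = 0 that
   of two cross-intersecting families of equal uniformity. *)
Section Reflect.
Variables (n p q e : nat) (P Q L : seq (seq bool)).
Hypotheses (pq : p = q + e) (e1 : e <= 1) (npq : p + q <= n).
Hypotheses (sP : forall a, a \in P -> size a = n) (sQ : forall b, b \in Q -> size b = n).
Hypotheses (cP : forall a, a \in P -> count id a = p) (cQ : forall b, b \in Q -> count id b = q).
Hypotheses (uP : uniq P) (uQ : uniq Q) (QL : {subset Q <= L}).
Hypotheses (swP : swap_closed (mem P)) (swQ : swap_closed (mem Q)).
Hypothesis crPQ : forall a b, a \in P -> b \in Q -> meet a b.
Hypothesis crPP : e = 1 -> forall a b, a \in P -> b \in P -> meet a b.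
Hypothesis reflL : forall a i, a \in P -> i <= n -> 2 * cnt i a = i + e -> reflect_word i a \in L.

(* The maximum over the empty set would be 0; turningP shows that the set is not empty. *)
Definition turning a := \max_(l < n.+1 | l + e <= 2 * cnt l a) l.

(** From one prefix to the next [2 * cnt l a - l] changes by one, so the last prefix with value at
    least [e] has value exactly [e]; if it is the whole word, [npq] gives this. Such a prefix is the
    empty one for [e = 0], and comes from the ballot of [P] against itself for [e = 1]. *)
Lemma turnP a : a \in P -> [/\ turning a <= n, 2 * cnt (turning a) a = turning a + e &
  forall l, turning a < l <= n -> 2 * cnt l a < l + e].
Proof.
move=> aP.
have mx l : turning a < l <= n -> 2 * cnt l a < l + e.
  case/andP=> tl ln; rewrite ltnNge; apply/negP => h; move: tl; rewrite ltnNge => /negP[].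
  by rewrite /turning; apply: (bigmax_sup (Ordinal (ln : l < n.+1))); rewrite /=.
have [l0 l0n hl0] : exists2 l, l <= n & l + e <= 2 * cnt l a.
  have [e0|e0] : e = 0 \/ e = 1 by lia.
    by exists 0; rewrite // e0.
  have [l ln hl] := cross_ballot sP sP swP swP (crPP e0) aP aP.
  by exists l => //; lia.
have [t ht et] : exists2 t : 'I_n.+1, t + e <= 2 * cnt t a & turning a = t.
  have := @eq_bigmax_cond _ (fun l : 'I_n.+1 => l + e <= 2 * cnt l a) (@nat_of_ord n.+1).
  case; first by apply/card_gt0P; exists (Ordinal (l0n : l0 < n.+1)).
  by move=> t; move=> ht et; exists t.
have tn : t <= n by rewrite -ltnS.
rewrite et in mx *; split=> //.
case: (ltnP t n) => [lt|ge].
  have := mx t.+1; rewrite ltnSn lt => /(_ isT); rewrite cnt_nth; lia.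
have et' : (t : nat) = n by lia.
by move: ht; rewrite et' cnt_size ?sP // cP //; lia.
Qed.

(** [a] and its image have together [l] ones in a prefix of length [l] up to the turning point and
    fewer beyond, against [cross_ballot]. *)
Lemma refl_notin a : a \in P -> reflect_word (turning a) a \notin Q.
Proof.
move=> aP; apply/negP => bQ; have [tn ht mx] := turnP aP.
have [l ln] := cross_ballot sP sQ swP swQ crPQ aP bQ.
have ta : turning a <= size a by rewrite sP.
case: (leqP l (turning a)) => lt.
  by have := cnt_refl_low lt ta; lia.
have := cnt_refl_high (ltnW lt) ta; have := mx l; rewrite lt ln => /(_ isT); lia.
Qed.

(** The turning point is visible in the image: it is the last [l] at which twice the prefix count
    plus [e] reaches [l]. *)
Lemma refl_turn_inj : {in P &, injective (fun a => reflect_word (turning a) a)}.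
Proof.
have key a b : a \in P -> b \in P -> reflect_word (turning a) a = reflect_word (turning b) b -> turning b <= turning a.
  move=> aP bP eab; rewrite leqNgt; apply/negP => lt.
  have [ta ha ma] := turnP aP; have [tb hb mb] := turnP bP.
  have ta' : turning a <= size a by rewrite sP.
  have tb' : turning b <= size b by rewrite sP.
  have := cnt_refl_high (ltnW lt) ta'; have := cnt_refl_high (leqnn _) tb'.
  have := ma (turning b); rewrite lt tb => /(_ isT); rewrite eab; lia.
move=> a b aP bP eab; have te : turning a = turning b.
  by apply/eqP; rewrite eqn_leq !key.
by move: eab; rewrite te => /refl_inj.
Qed.

Lemma reflect_bound : size P + size Q <= size L.
Proof.
rewrite -(size_map (fun a => reflect_word (turning a) a) P) -size_cat; apply: uniq_leq_size.
  rewrite cat_uniq uQ (map_inj_in_uniq refl_turn_inj) uP andbT /=.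
  by apply/hasPn => b bQ; apply/negP => /mapP[a aP eb]; have := refl_notin aP; rewrite -eb bQ.
move=> w; rewrite mem_cat => /orP[/mapP[a aP ->]|/QL //].
by have [tn ht _] := turnP aP; apply: reflL.
Qed.

(* A word lying in neither Q nor the reflected image of P, which makes the bound strict. *)
Definition gap := nseq p.+1 false ++ nseq q true ++ nseq (n - (p + q).+1) false.

Lemma cnt_gap l : cnt l gap = minn (l - p.+1) q.
Proof.
have cn (b : bool) m k : count id (take k (nseq m b)) = b * minn k m.
  elim: m k => [|m IH] [|k] /=; rewrite ?muln0 ?minn0 ?min0n ?muln0 //.
  by rewrite IH minnSS mulnS.
rewrite /cnt /gap take_cat size_nseq; case: ltnP => h.
  by rewrite cn; lia.
rewrite count_cat take_cat size_nseq; case: ltnP => h'; rewrite ?count_cat ?cn ?count_nseq /=; lia.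
Qed.

Lemma gap_low a : count id a <= p -> forall l, cnt l a + cnt l gap <= l.
Proof. by move=> ca l; rewrite cnt_gap; have := cnt_le l a; have := cnt_count l a; lia. Qed.

Lemma reflect_strict : (p + q).+1 <= n -> gap \in L -> P != [::] ->
  (e = 0 -> Q != [::]) ->
  (e = 1 -> forall w, true :: w \in P -> false :: w \in Q) ->
  size P + size Q < size L.
Proof.
move=> n1 gL P0 hQ hPQ.
have [a0 a0P] : exists a, a \in P by case: (P) P0 => // a s _; exists a; rewrite mem_head.
have gQ : gap \notin Q.
  apply/negP => gQ; have [l ln] := cross_ballot sP sQ swP swQ crPQ a0P gQ.
  by have := gap_low (eq_leq (cP a0P)) l; lia.
(* Prefix counts force [turning a = e]. For [e = 0] the word [a] is [gap] itself, whose ones come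
   too late for the ballot against [Q]; for [e = 1] it differs from [gap] in the first letter only,
   so [gap] would lie in [Q]. *)
have gR : gap \notin map (fun a => reflect_word (turning a) a) P.
  apply/negP => /mapP[a aP eg]; have [tn ht mx] := turnP aP.
  have ta : turning a <= size a by rewrite sP.
  have := cnt_refl_low (leqnn _) ta; rewrite -eg cnt_gap => hg.
  have te : turning a = e by lia.
  have [e0|e0] : e = 0 \/ e = 1 by lia.
    have ag : a = gap by rewrite eg te e0 /reflect_word take0 drop0.
    have [b bQ] : exists b, b \in Q by case: (Q) (hQ e0) => // b s _; exists b; rewrite mem_head.
    have [l ln] := cross_ballot sP sQ swP swQ crPQ aP bQ.
    have cb : count id b <= p by rewrite cQ //; lia.
    by have := gap_low cb l; rewrite ag; lia.
  have a1 : cnt 1 a = 1 by move: ht; rewrite te e0; lia.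
  have ea : a = true :: behead a by case: (a) a1 => [|[] s] //=; rewrite /cnt /= take0.
  have eg' : gap = false :: behead a by rewrite eg te e0 {1}ea /reflect_word /= take0 drop0.
  by move: gQ; rewrite eg' => /negP[]; apply: hPQ => //; rewrite -ea.
rewrite -(size_map (fun a => reflect_word (turning a) a) P) -size_cat.
apply: (@uniq_leq_size _ (gap :: _)).
  rewrite cons_uniq mem_cat negb_or gR gQ /= cat_uniq uQ (map_inj_in_uniq refl_turn_inj) uP andbT /=.
  by apply/hasPn => b bQ; apply/negP => /mapP[a aP eb]; have := refl_notin aP; rewrite -eb bQ.
move=> w; rewrite inE mem_cat => /orP[/eqP -> //|/orP[/mapP[a aP ->]|/QL //]].
by have [tn ht _] := turnP aP; apply: reflL.
Qed.
End Reflect.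
End Words.

(** * Bounds for cross-intersecting families *)

Section FamilyBound.
Variables (K : fieldType) (V : finType) (r : nat -> K) (r_inj : injective r).
Local Notation chain := {ffun {set V} -> K^o}.
Local Notation functional := {ffun V -> K^o}.
Implicit Types (A B C U s : {set V}) (v : V) (x y z : chain) (f g h : functional).
Implicit Types (L X Y Z : {set {set V}}) (fs gs : seq functional) (a b w : seq bool).

Lemma meet_of_zip a b : ~~ all (fun p => ~~ (p.1 && p.2)) (zip a b) -> meet a b.
Proof.
elim: a b => [|c a IH] [|d b] //=; rewrite negb_and negbK => /orP[cd|/IH[i hi]].
  by exists 0.
by exists i.+1.
Qed.

Lemma words_cross fs X Y p q : detects fs -> (forall A, A \in X -> #|A| = p) ->
  (forall B, B \in Y -> #|B| = q) -> (forall A B, A \in X -> B \in Y -> A :&: B != set0) ->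
  forall a b, a \in words fs (span_of K X) -> b \in words fs (span_of K Y) -> meet a b.
Proof.
move=> df hX hY cr a b /mem_words[x /span_ofP xX la] /mem_words[y /span_ofP yY lb].
apply: meet_of_zip; apply/negP => dj.
have hx : homog p x by move=> A /xX /hX.
have hy : homog q y by move=> A /yY /hY.
apply: (lead_wedge df hx hy la lb dj); apply/ffunP=> C; rewrite !ffunE big1 // => A _.
have [->|/xX AX] := eqVneq (x A) 0%R; first by rewrite mul0r mulr0.
have [->|/yY BY] := eqVneq (y (C :\: A)) 0%R; first by rewrite !mulr0.
by have := cr _ _ AX BY; rewrite setIDA setIC setDIl setDv setI0 eqxx.
Qed.

Definition level L q : {set {set V}} := [set A in L | #|A| == q].

Lemma chains_of_level L q x : (x \in span_of K (level L q)) <-> chains_of L q x.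
Proof.
split=> [/span_ofP h A /h|h]; first by rewrite inE => /andP[? /eqP].
by apply/span_ofP => A /h[AL <-]; rewrite inE AL eqxx.
Qed.

(** A face of maximum size below [D] would have only the empty face in its link, which is not
    acyclic in degree 0. *)
Lemma class_face L D : cm_class K L D -> set0 \in L -> exists2 A, A \in L & #|A| = D.
Proof.
move=> [dL hL] L0; case: (@arg_maxnP _ set0 (mem L) (fun A => #|A|) L0) => A AL mx.
have [h|h] := ltnP #|A| D; last first.
  have : exists2 B : {set V}, B \subset A & #|B| = D.
    have : (0 < #|[set B : {set V} | B \subset A & #|B| == D]|)%N by rewrite cards_draws bin_gt0.
    by case/card_gt0P => B; rewrite inE => /andP[? /eqP ?]; exists B.
  by case=> B sB e; exists B => //; apply: dL AL sB.
have [||y hy e] := hL A 0%N AL h (face K set0).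
- move=> B; rewrite ffunE; case: (eqVneq B set0) => [->|]; last by rewrite eqxx.
  by rewrite cards0 link_in // disjoint_sym -setI_eq0 set0I eqxx setU0.
- by apply: homog_bd0 => B; rewrite ffunE; case: (eqVneq B set0) => [->|]; rewrite ?cards0 // eqxx.
have : face K (set0 : {set V}) set0 != 0%R by rewrite ffunE eqxx oner_neq0.
rewrite e => /bdr_neq0[v _ /hy[]]; rewrite setU0 link_in // => /andP[]; rewrite disjoint_sym disjoints1 => vA.
by rewrite setUC => /mx; rewrite /geq /= cardsU1 vA ltnn.
Qed.

Lemma lead_prefix0 fs1 fs2 w x : lead (fs1 ++ fs2) (nseq (size fs1) false ++ w) x ->
  forall f, f \in fs1 -> bdr f x = 0%R.
Proof.
elim: fs1 => //= f fs1 IH [h l] g; rewrite inE => /orP[/eqP -> //|]; exact: IH.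
Qed.

Lemma lead_homog0 fs x : homog 0 x -> x <> 0%R -> lead fs (nseq (size fs) false) x.
Proof. by move=> hx x0; elim: fs => //= f fs; split=> //; apply: homog_bd0. Qed.

Lemma subword_refl w : subword w w.
Proof. by elim: w => //= b w ->; case: b. Qed.

Lemma subword_cat w1' w1 w2 w2' : subword w1' w1 -> subword w2' w2 -> subword (w1' ++ w2') (w1 ++ w2).
Proof.
by elim: w1 w1' => [|b w1 IH] [|b' w1'] //= /andP[-> h] h2; rewrite IH.
Qed.

Lemma subword_false w n : size w = n -> subword (nseq n false) w.
Proof. by move=> <-; elim: w. Qed.

Lemma subword_true w n : size w = n -> subword w (nseq n true).
Proof. by move=> <-; elim: w => //= b w ->; case: b. Qed.

Lemma words_sub L fs w w' k k' : down_closed L -> subword w' w -> count id w = k -> count id w' = k' ->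
  w \in words fs (span_of K (level L k)) -> w' \in words fs (span_of K (level L k')).
Proof.
move=> dL sw cw cw' /mem_words[x /chains_of_level hx l].
have [gs sz l'] := lead_subword sw l; apply/mem_words; exists (bdl gs x) => //.
apply/chains_of_level/chains_of_bdl => //; rewrite sz cw cw' subnKC //.
by rewrite -cw -cw' subword_count.
Qed.

(** A chain whose word begins with [i] zeros is killed by the first [i] functionals, hence is their
    iterated boundary by exactness; the preimage has ones there. *)
Lemma words_raise L D fs i w k : cm_class K L D -> good [set: V] fs -> (i <= size fs)%N ->
  (k + i <= D)%N -> nseq i false ++ w \in words fs (span_of K (level L k)) ->
  nseq i true ++ w \in words fs (span_of K (level L (k + i))).
Proof.
move=> cL gfs ifs kD /mem_words[x /chains_of_level hx l].
have si : size (take i fs) = i by rewrite size_takel.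
have gi : good [set: V] (take i fs) by apply: good_prefix (drop i fs) _; rewrite cat_take_drop.
have {}l : lead (take i fs ++ drop i fs) (nseq (size (take i fs)) false ++ w) x.
  by rewrite cat_take_drop si.
have [|y hy e] := class_kernels_exact cL (fun A _ => subsetT A) gi _ hx (lead_prefix0 l).
  by rewrite si.
apply/mem_words; exists y; first by apply/chains_of_level; rewrite si in hy.
by have := lead_ones e l; rewrite cat_take_drop si.
Qed.

Section Bound.
Variables (L X Y : {set {set V}}) (D p q e : nat).
Hypotheses (cL : cm_class K L D) (L0 : set0 \in L) (pq : p = (q + e)%N) (e1 : (e <= 1)%N).
Hypotheses (XL : X \subset L) (YL : Y \subset L).
Hypotheses (hX : forall A, A \in X -> #|A| = p) (hY : forall B, B \in Y -> #|B| = q).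
Hypothesis crXY : forall A B, A \in X -> B \in Y -> A :&: B != set0.
Hypothesis crXX : e = 1%N -> forall A B, A \in X -> B \in X -> A :&: B != set0.
Hypothesis pqD : (p + q <= D)%N.

Lemma class_card : (D <= #|V|)%N.
Proof. by have [A _ <-] := class_face cL L0; apply: max_card. Qed.

Lemma span_homog Z k : (forall A, A \in Z -> #|A| = k) -> forall x, x \in span_of K Z -> homog k x.
Proof. by move=> hZ x /span_ofP xZ A /xZ /hZ. Qed.

Lemma words_span_count fs Z k w : detects fs -> (forall A, A \in Z -> #|A| = k) ->
  w \in words fs (span_of K Z) -> count id w = k.
Proof. by move=> df hZ /mem_words[x /(span_homog hZ) hx l]; apply: lead_count df hx l. Qed.

Lemma words_span_size fs Z k : detects fs -> (forall A, A \in Z -> #|A| = k) ->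
  size (words fs (span_of K Z)) = #|Z|.
Proof. by move=> df hZ; rewrite (size_words df (span_homog hZ)) dim_span_of. Qed.

Lemma span_of_sub Z Z' fs : Z \subset Z' ->
  {subset words fs (span_of K Z) <= words fs (span_of K Z')}.
Proof.
move=> /subsetP sZ w /mem_words[x /span_ofP xZ l]; apply/mem_words; exists x => //.
by apply/span_ofP => A /xZ /sZ.
Qed.

Lemma level_card k A : A \in level L k -> #|A| = k.
Proof. by rewrite inE => /andP[_ /eqP]. Qed.

(** The prefix is erased, filled with ones, then cut down to the complement. The filled word has
    [q + cnt i a <= p + q] ones, so [pqD] allows the filling. *)
Lemma words_reflect fs a i : size fs = #|V| -> good [set: V] fs -> detects fs ->
  a \in words fs (span_of K X) -> (i <= #|V|)%N -> (2 * cnt i a = i + e)%N ->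
  reflect_word i a \in words fs (span_of K (level L q)).
Proof.
move=> sfs gfs dfs aP iV ci; have [dL _] := cL.
have sa := words_size aP; have ca := words_span_count dfs hX aP.
have ia : (i <= size a)%N by rewrite sa sfs.
pose k := count id (drop i a).
have ck : (cnt i a + k = p)%N by rewrite -ca -{2}(cat_take_drop i a) count_cat.
have aL : a \in words fs (span_of K (level L p)).
  apply: span_of_sub aP; apply/subsetP=> A AX; by rewrite inE (subsetP XL) // hX /=.
have st : size (take i a) = i by rewrite size_takel.
have w0 : nseq i false ++ drop i a \in words fs (span_of K (level L k)).
  apply: words_sub aL => //; last by rewrite count_cat count_nseq.
  by rewrite -{2}(cat_take_drop i a); apply: subword_cat (subword_refl _); apply: subword_false.
have w1 := words_raise cL gfs _ _ w0.
apply: words_sub (w1 _ _) => //.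
- by apply: subword_cat (subword_refl _); apply: subword_true; rewrite size_map.
- by rewrite count_cat count_nseq /= mul1n -/k addnC.
- rewrite count_cat -/k count_map; have := count_predC id (take i a); rewrite st.
  rewrite -/(cnt i a) (eq_count (a2 := preim negb id)) //; lia.
- by rewrite sfs.
lia.
Qed.

Theorem family_bound : (#|X| + #|Y| <= fnum L q)%N.
Proof.
have [fs [sfs gfs swX swY]] := generic_exists r_inj hX hY.
have dfs : detects fs by apply: good_detects; rewrite ?sfs.
rewrite -(words_span_size dfs hX) -(words_span_size dfs hY) -[fnum L q]/#|level L q|.
rewrite -(words_span_size dfs (@level_card q)).
apply: (@reflect_bound #|V| p q e) => //.
- exact: leq_trans pqD class_card.
- by move=> a /words_size ->.
- by move=> a /words_size ->.
- by move=> a; apply: words_span_count.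
- exact: words_uniq.
- exact: words_uniq.
- by apply: span_of_sub; apply/subsetP=> A AY; rewrite inE (subsetP YL) // hY /=.
- exact: words_cross dfs hX hY crXY.
- by move=> /crXX cr; apply: (words_cross dfs hX hX cr).
by move=> a i aP iV ci; apply: words_reflect.
Qed.

Theorem family_strict : (p + q < D)%N -> X != set0 -> (e = 0 -> Y != set0)%N ->
  (e = 1%N -> forall A v, A \in X -> v \in A -> A :\ v \in Y) ->
  (#|X| + #|Y| < fnum L q)%N.
Proof.
move=> pqD' X0 Y0 shXY; have [dL _] := cL.
have [fs [sfs gfs swX swY]] := generic_exists r_inj hX hY.
have dfs : detects fs by apply: good_detects; rewrite ?sfs.
have nV : ((p + q).+1 <= #|V|)%N by apply: leq_trans pqD' class_card.
rewrite -(words_span_size dfs hX) -(words_span_size dfs hY) -[fnum L q]/#|level L q|.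
rewrite -(words_span_size dfs (@level_card q)).
apply: (@reflect_strict #|V| p q e) => //.
- exact: leq_trans pqD class_card.
- by move=> a /words_size ->.
- by move=> a /words_size ->.
- by move=> a; apply: words_span_count.
- by move=> a; apply: words_span_count.
- exact: words_uniq.
- exact: words_uniq.
- by apply: span_of_sub; apply/subsetP=> A AY; rewrite inE (subsetP YL) // hY /=.
- exact: words_cross dfs hX hY crXY.
- by move=> /crXX cr; apply: (words_cross dfs hX hX cr).
- by move=> a i aP iV ci; apply: words_reflect.
(* The empty face has the zero word; filling its first [p + q + 1] letters, within [D], gives a word
   above [gap]. *)
- pose m := (p + q).+1.
  have w0 : nseq m false ++ nseq (#|V| - m) false \in words fs (span_of K (level L 0)).
    rewrite -nseqD subnKC // -sfs; apply/mem_words; exists (face K set0).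
      apply/chains_of_level => B; rewrite ffunE; case: (eqVneq B set0) => [->|]; last by rewrite eqxx.
      by rewrite cards0.
    apply: lead_homog0; first by move=> B; rewrite ffunE; case: (eqVneq B set0) => [->|]; rewrite ?cards0 // eqxx.
    by move/ffunP/(_ set0)/eqP; rewrite !ffunE eqxx oner_eq0.
  have mfs : (m <= size fs)%N by rewrite sfs.
  have mD : (0 + m <= D)%N by [].
  have := words_raise cL gfs mfs mD w0; apply: words_sub => //.
  + rewrite /gap catA; apply: subword_cat (subword_refl _).
    by apply: subword_true; rewrite size_cat !size_nseq /m; lia.
  + by rewrite count_cat !count_nseq /=; lia.
  by rewrite !count_cat !count_nseq /=; lia.
- by rewrite -size_eq0 (words_span_size dfs hX) cards_eq0.
- by move=> /Y0; rewrite -size_eq0 (words_span_size dfs hY) cards_eq0.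
(* If [true :: w] leads [x], then [bdr f x] is carried by [Y] and killed by [f], so [false :: w]
   leads it. *)
move=> /shXY sh w /mem_words[x /span_ofP xX]; case: (fs) => [[]|f fs' l].
apply/mem_words; exists (bdr f x); last by split=> //; apply: bdr_sq.
by apply/span_ofP => B /bdr_neq0[v vB /xX AX]; rewrite -(setU1K vB); apply: sh AX (setU11 _ _).
Qed.
End Bound.
End FamilyBound.

(** * Extension of scalars *)

Section Transfer.
Variables (F K : fieldType) (V : finType) (phi : {rmorphism F -> K}).
Implicit Types (A B : {set V}) (D : {set {set V}}).
Local Open Scope ring_scope.

Lemma map_bd D k : map_mx phi (Defs.bd F D k) = Defs.bd K D k.
Proof.
apply/matrixP=> i j; rewrite !mxE /bd_sign; case: ifP => _; last exact: rmorph0.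
by rewrite rmorphXn rmorphN rmorph1.
Qed.

Lemma map_chains D k : map_mx phi (chains F D k) = chains K D k.
Proof.
apply/matrixP=> i j; rewrite !mxE rmorphMn; congr (_ *+ _).
by case: ifP => _; rewrite ?rmorph1 ?rmorph0.
Qed.

Lemma rhom_vanishes_map D k : rhom_vanishes F D k -> rhom_vanishes K D k.
Proof.
rewrite /rhom_vanishes -!map_bd -map_chains -map_kermx.
by rewrite -(map_submx phi) map_capmx.
Qed.
End Transfer.

(** * From matrices to chains; purity; deletion *)

Section Bridge.
Variables (K : fieldType) (V : finType).
Local Notation chain := {ffun {set V} -> K^o}.
Implicit Types (A B : {set V}) (D L : {set {set V}}) (x y : chain).
Local Open Scope ring_scope.

Definition row_of x : 'rV[K]_#|{set V}| := \row_i x (enum_val i).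

Lemma bd_sign_ninv v B : v \notin B -> bd_sign K (v |: B) B = (-1) ^+ ninv [set v] B.
Proof.
move=> vB; rewrite /bd_sign; congr (_ ^+ _).
rewrite /ninv big_set1 -sum1_card big_mkcond [RHS]big_mkcond; apply: eq_bigr => w _.
rewrite inE; case: (w \in B) => //=.
have -> : (v |: B) :\: B = [set v] by rewrite setDUl setDv setU0; apply/setDidPl; rewrite disjoints1.
case: existsP => [[u]|no]; first by rewrite inE => /andP[/eqP -> ->].
by case: ltnP => // h; case: no; exists v; rewrite inE eqxx.
Qed.

Lemma row_of_bdr D k x : chains_of D k x -> row_of x *m Defs.bd K D k = row_of (bdr (ones K V) x).
Proof.
move=> hx; apply/rowP=> j; rewrite !mxE bdrE; set B := enum_val j.
transitivity (\sum_(A : {set V} | (B \subset A) && (#|B|.+1 == #|A|)) bd_sign K A B * x A).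
  rewrite [RHS](reindex (fun i : 'I_#|{set V}| => enum_val i)) /=; last by apply: onW_bij; apply: enum_val_bij.
  rewrite [RHS]big_mkcond; apply: eq_bigr => i _; rewrite !mxE /= -/B.
  have [->|/hx[AD Ak]] := eqVneq (x (enum_val i)) 0; first by rewrite mul0r mulr0 if_same.
  by rewrite AD Ak eqxx /=; case: ifP => _; rewrite ?mulr0 // mulrC.
have -> : \sum_(A : {set V} | (B \subset A) && (#|B|.+1 == #|A|)) bd_sign K A B * x A
   = \sum_(A in [set v |: B | v in ~: B]) bd_sign K A B * x A.
  apply: eq_bigl => A; apply/andP/imsetP => [[sB cA]|[v]].
    have : #|A :\: B| == 1%N by rewrite cardsD (setIidPr sB) -(eqP cA) subSnn.
    case/cards1P => v hv; exists v.
      by rewrite inE; have := set11 v; rewrite -hv inE => /andP[].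
    by rewrite -hv setUC -[LHS](setID A B) (setIidPr sB).
  by rewrite inE => vB ->; rewrite subsetUr cardsU1 vB.
rewrite big_imset /=; last first.
  by move=> v w; rewrite !inE => vB wB /setP/(_ v); rewrite setU11 => /esym; rewrite !inE (negPf vB) orbF => /eqP.
by apply: eq_big => [v|v]; rewrite inE // => vB; rewrite bd_sign_ninv // ffunE mul1r.
Qed.

Lemma row_of_inj : injective row_of.
Proof.
move=> x y /rowP h; apply/ffunP=> A; have := h (enum_rank A).
by rewrite !mxE enum_rankK.
Qed.

Lemma rhom_acyclic D k : rhom_vanishes K D k -> acyclic K D k.
Proof.
move=> hv x hx x0.
have : (row_of x <= kermx (Defs.bd K D k) :&: chains K D k)%MS.
  rewrite sub_capmx; apply/andP; split.
    apply/sub_kermxP; rewrite row_of_bdr // x0; apply/rowP=> j.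
    by rewrite !mxE ffunE.
  apply/submxP; exists (row_of x); apply/rowP=> j; rewrite mul_mx_diag !mxE.
  have [->|/hx[AD Ak]] := eqVneq (x (enum_val j)) 0; first by rewrite mul0r.
  by rewrite AD Ak eqxx mulr1.
move=> /submx_trans/(_ hv)/submxP[u ue].
(* The preimage given by matrices may have entries off the faces; these meet zero rows of [bd] and
   are cut away. *)
pose y : chain := [ffun A => if (A \in D) && (#|A| == k.+1) then u 0 (enum_rank A) else 0].
have hy : chains_of D k.+1 y.
  by move=> A; rewrite ffunE; case: ifP => [/andP[-> /eqP]|]; rewrite ?eqxx.
exists y => //; apply: row_of_inj; rewrite -(row_of_bdr hy) ue.
apply/rowP=> j; rewrite !mxE; apply: eq_bigr => i _; rewrite !mxE ffunE enum_valK /=.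
case: (boolP (enum_val i \in D)) => h1 /=; last by rewrite mulr0 mul0r.
by case: (boolP (#|enum_val i| == k.+1)) => h2 //=; rewrite mulr0 mul0r.
Qed.

Lemma face_vmul v : vmul v (face K (set0 : {set V})) = face K [set v].
Proof.
apply/ffunP=> B; rewrite !ffunE; case: (boolP (v \in B)) => vB.
  have -> : (B :\ v == set0) = (B == [set v]).
    by rewrite setD_eq0 subset1; case: eqVneq => //= B0; case: eqVneq vB => // ->; rewrite inE.
  case: eqVneq => [->|_]; rewrite ?mulr0 //.
  by rewrite setDv /ninv big_set1 big_set0 mul1r.
by case: eqVneq vB => // ->; rewrite set11.
Qed.

(** A chain with boundary [u - v] is restricted to the edges inside [P]. No edge leaves [P], so the
    new boundary keeps exactly the endpoints in [P]; its coefficients sum to zero, so both or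
    neither lie in [P]. *)
Lemma acyclic1_connected L (P : pred V) u v : down_closed L -> acyclic K L 1 ->
  [set u] \in L -> [set v] \in L -> 
  (forall w w', w != w' -> [set w; w'] \in L -> P w = P w') -> P u = P v.
Proof.
move=> dL ac uL vL hP.
pose x : chain := face K [set u] - face K [set v].
have hf w : [set w] \in L -> chains_of L 1 (face K [set w]).
  by move=> wL A; rewrite ffunE; case: (eqVneq A [set w]) => [->|]; rewrite ?cards1 // eqxx.
have bf w : bdr (ones K V) (face K [set w]) = face K set0.
  rewrite -face_vmul bdr_vmul ffunE scale1r homog_bd0 ?vmul0 ?subr0 // => A.
  by rewrite ffunE; case: (eqVneq A set0) => [->|]; rewrite ?cards0 // eqxx.
have [||y hy xy] := ac x.
- by apply: chains_ofB; apply: hf.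
- by rewrite bdrB !bf subrr.
pose yP : chain := [ffun A : {set V} => if [forall w in A, P w] then y A else 0].
have byP w : bdr (ones K V) yP [set w] = if P w then x [set w] else 0.
  rewrite xy !bdrE; case: (boolP (P w)) => Pw; last first.
    rewrite big1 // => w' _; rewrite !ffunE ifF ?mulr0 //; apply/negbTE/negP => /forall_inP/(_ w).
    by rewrite (negPf Pw) !inE eqxx orbT => /(_ isT).
  apply: eq_bigr => w'; rewrite inE => ww'; rewrite !ffunE.
  have [->|/hy[yL _]] := eqVneq (y (w' |: [set w])) 0; first by rewrite if_same.
  rewrite ifT //; apply/forall_inP => w''; rewrite !inE => /orP[/eqP ->|/eqP -> //].
  by rewrite (hP w' w).
have := bdr_sq (ones K V) yP; move/ffunP/(_ set0); rewrite bdrE [RHS]ffunE.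
under eq_bigr => w _ do rewrite setU0 byP /ninv big_set1 big_set0 expr0 mul1r ffunE mul1r.
rewrite (eq_bigl xpredT) => [|w]; last by rewrite inE.
rewrite (eq_bigr (fun w => (if w == u then (P u)%:R else 0) - (if w == v then (P v)%:R else 0))).
  rewrite sumrB -!big_mkcond !big_pred1_eq.
  by case: (P u); case: (P v) => //= /eqP; rewrite ?subr0 ?sub0r ?oppr_eq0 oner_eq0.
move=> w _; rewrite !ffunE !(inj_eq (@set1_inj V)).
case: (eqVneq w u) => wu; case: (eqVneq w v) => wv /=.
- by rewrite -wu -wv !subrr if_same.
- by rewrite -wu !subr0; case: (P w).
- by rewrite -wv !sub0r; case: (P w); rewrite ?oppr0.
by rewrite subrr if_same.
Qed.

Lemma maxsize_ge L A : A \in L -> (#|A| <= maxsize L)%N.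
Proof. by move=> AL; apply: (@leq_bigmax_cond _ (mem L) (fun A : {set V} => #|A|)). Qed.

Lemma maxsize_face L : set0 \in L -> exists2 A, A \in L & #|A| = maxsize L.
Proof.
move=> L0; have := @eq_bigmax_cond _ (mem L) (fun A : {set V} => #|A|).
by case=> [|A AL e]; [apply/card_gt0P; exists set0 | exists A].
Qed.

Lemma link_nonempty L A : down_closed L -> A \in L -> set0 \in link L A.
Proof. by move=> dL AL; rewrite link_in // disjoint_sym -setI_eq0 set0I eqxx setU0. Qed.

Lemma link_addv L A v B : down_closed L -> v \notin A -> v \notin B ->
  (B \in link L (v |: A)) = (v |: B \in link L A).
Proof.
move=> dL vA vB; rewrite !link_in // disjointU1s disjointsU1 vA vB /=.
by rewrite setUCA setUA.
Qed.

Lemma link_notin L A v B : down_closed L -> B \in link L (v |: A) -> v \notin B.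
Proof. by move=> dL; rewrite link_in // disjointU1s => /andP[/andP[]]. Qed.

(** Purity from connectedness: for adjacent vertices [w], [w'] of the link of [A], induction at
    [w |: A] and [w' |: A] shows that their links have equal size, and a vertex of a largest face of
    the link loses exactly one. *)
Lemma links_pure L : down_closed L ->
  (forall A k, A \in L -> (k < maxsize (link L A))%N -> acyclic K (link L A) k) ->
  forall A v, v \notin A -> v |: A \in L -> (maxsize (link L (v |: A))).+1 = maxsize (link L A).
Proof.
move=> dL hL A v; have [n] := ubnP (maxsize (link L A)); elim: n A v => // n IH A v.
pose c A := maxsize (link L A); rewrite -/(c A) -/(c (v |: A)) ltnS => cn vA vAL.
have up w : w \notin A -> w |: A \in L -> (c (w |: A) < c A)%N.
  move=> wA wAL; rewrite {1}/c; have [B BL <-] := maxsize_face (link_nonempty dL wAL).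
  have wB := link_notin dL BL; move: BL; rewrite link_addv // => /maxsize_ge.
  by rewrite cardsU1 wB.
have AL : A \in L by apply: dL vAL (subsetUr _ _).
have [B BL cB] := maxsize_face (link_nonempty dL AL).
have c0 := up v vA vAL.
have [u uB] : exists u, u \in B by apply/set0Pn; rewrite -card_gt0 cB; apply: leq_ltn_trans c0.
have [uA uAL] : u \notin A /\ u |: A \in L.
  move: BL; rewrite link_in // -(setD1K uB) disjointsU1 => /andP[/andP[uA _] h]; split=> //.
  by apply: dL h _; rewrite setUC setUS // subsetUl.
have cu : (c (u |: A)).+1 == c A.
  rewrite eqn_leq up //= /c -cB (cardsD1 u B) uB ltnS; apply: maxsize_ge.
  by rewrite link_addv ?setD11 // setD1K.
case: (ltnP 1 (c A)) => c1; last first.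
  by apply/eqP; rewrite eqn_leq c0 (leq_trans c1).
have sin w : ([set w] \in link L A) = (w \notin A) && (w |: A \in L).
  by rewrite link_in // disjoint_sym disjoints1 setUC.
have e1 : ((c (v |: A)).+1 == c A) = ((c (u |: A)).+1 == c A).
  apply: (@acyclic1_connected (link L A) (fun w => (c (w |: A)).+1 == c A)).
  - exact: link_down.
  - exact: hL.
  - by rewrite sin vA.
  - by rewrite sin uA.
  move=> w w' ww' h.
  have [wA w'A] : w \notin A /\ w' \notin A.
    by move: h; rewrite link_in // disjointsU1 disjoint_sym disjoints1 => /andP[/andP[]].
  have wL : w |: (w' |: A) \in L by move: h; rewrite link_in // => /andP[_]; rewrite setUC setUA.
  have w'L : w' |: (w |: A) \in L by rewrite setUCA.
  have a1 : (c (w |: (w' |: A))).+1 = c (w' |: A).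
    apply: IH => //; last by rewrite !inE negb_or ww'.
    by apply: leq_trans cn; apply: up => //; apply: dL wL (subsetUr _ _).
  have a2 : (c (w' |: (w |: A))).+1 = c (w |: A).
    apply: IH => //; last by rewrite !inE negb_or eq_sym ww'.
    by apply: leq_trans cn; apply: up => //; apply: dL w'L (subsetUr _ _).
  by rewrite -a1 -a2 setUCA.
by apply/eqP; rewrite e1.
Qed.

Lemma links_pure_size L A : down_closed L ->
  (forall A k, A \in L -> (k < maxsize (link L A))%N -> acyclic K (link L A) k) ->
  A \in L -> (maxsize (link L A) + #|A|)%N = maxsize L.
Proof.
move=> dL hL; have [n] := ubnP #|A|; elim: n A => // n IH A An AL.
have [->|[v vA]] := set_0Vmem A.
  rewrite cards0 addn0; congr maxsize; apply/setP=> B.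
  by rewrite link_in // -setI_eq0 set0I eqxx set0U.
have AvL : A :\ v \in L by apply: dL AL (subD1set _ _).
have cA : #|A| = #|A :\ v|.+1 by rewrite (cardsD1 v) vA.
rewrite -(IH (A :\ v)) //; last by rewrite -ltnS -cA.
by rewrite -(@links_pure L dL hL (A :\ v) v) ?setD11 ?setD1K // cA addSnnS.
Qed.

Lemma cm_class_of_links L : down_closed L ->
  (forall A k, A \in L -> (k < maxsize (link L A))%N -> acyclic K (link L A) k) ->
  cm_class K L (maxsize L).
Proof.
move=> dL hL; split=> // s k sL ks; apply: (hL) => //.
by rewrite -(ltn_add2r #|s|) (links_pure_size dL hL sL).
Qed.

Definition deletion L v : {set {set V}} := [set A in L | v \notin A].

(** If [x] bounds [y = q + vmul v p] in the link of [s], then [x] is [p] plus the boundary of [q],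
    with [p] a cycle in the link of [v |: s], one vertex larger; [p] bounds there, or is 0 if
    [v |: s] is not a face. *)
Lemma deletion_class L v (D : nat) : cm_class K L D -> cm_class K (deletion L v) D.-1.
Proof.
move=> [dL hL].
have dd : down_closed (deletion L v).
  move=> A B; rewrite !inE => /andP[AL vA] sB; rewrite (dL _ _ AL sB).
  by apply: contra vA; apply: (subsetP sB).
split=> // s k; rewrite inE => /andP[sL vs] ksD x hx x0.
have lk B : (B \in link (deletion L v) s) = (B \in link L s) && (v \notin B).
  by rewrite !link_in // !inE negb_or vs -andbA.
have ksD' : (k + #|s| < D)%N by case: (D) ksD => //= D' h; apply: ltnW.
have hx' : chains_of (link L s) k x.
  by apply: chains_ofS hx; apply/subsetP=> B; rewrite lk => /andP[].
have [y hy xy] := hL s k sL ksD' x hx' x0.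
pose p := contr v y; pose q := off_apex v y.
have yE : y = q + vmul v p by rewrite /q /off_apex subrK.
have bdy : x = p - vmul v (bdr (ones K V) p) + bdr (ones K V) q.
  by rewrite xy {1}yE linearD /= bdr_vmul ffunE scale1r addrC.
have hp : chains_of (link (deletion L v) s) k p.
  move=> B /contr_neq0/andP[vB /hy[]]; rewrite cardsU1 vB => h [<-]; split=> //.
  by rewrite lk vB (link_down dL h) // subsetUr.
have hq : chains_of (link (deletion L v) s) k.+1 q.
  by move=> B; rewrite off_apexE; case: ifP; rewrite ?eqxx // => vB /hy[h ->]; rewrite lk h vB.
have p0 : bdr (ones K V) p = 0.
  rewrite /p -[bdr _ _]opprK -contr_bdr -xy; apply/eqP; rewrite oppr_eq0; apply/eqP/ffunP=> B.
  rewrite !ffunE; case: ifP => // vB; apply/eqP; rewrite mulf_eq0; apply/orP; right.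
  by apply/negPn/negP => /hx[]; rewrite lk setU11 andbF.
have {}xpq : x = p + bdr (ones K V) q by rewrite bdy p0 vmul0 subr0.
case: (boolP (v |: s \in L)) => vsL.
  have hp' : chains_of (link L (v |: s)) k p.
    move=> B Bp; have [h ->] := hp _ Bp; split=> //.
    by move: Bp => /contr_neq0/andP[vB /hy[]]; rewrite -link_addv.
  have [|p' hp'' pE] := hL (v |: s) k vsL _ p hp' p0.
    by rewrite cardsU1 vs addnS; case: (D) ksD.
  exists (p' + q); last by rewrite linearD /= -pE.
  apply: chains_ofD hq => B /hp''[h ->]; split=> //; have vB := link_notin dL h.
  move: h; rewrite link_addv // lk vB andbT => h.
  by apply: link_down dL _ _ h _; apply: subsetUr.
have pz : p = 0.
  apply/ffunP=> B; rewrite [RHS]ffunE; apply/eqP/negPn/negP => /contr_neq0/andP[vB /hy[h _]].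
  case/negP: vsL; move: h; rewrite link_in // => /andP[_] h; apply: dL h _.
  by rewrite setUCA setUA; apply: subsetUl.
by exists q => //; rewrite xpq pz add0r.
Qed.
End Bridge.

(** * An infinite field and the depth hypothesis *)

Section Extension.
Variables (F : fieldType) (V : finType).
Implicit Types (D : {set {set V}}).
Local Open Scope ring_scope.

Definition ext_field : fieldType := {fraction {poly F}}.
Definition ext_inj : {rmorphism F -> ext_field} := (@FracField.tofrac {poly F}) \o (@polyC F).
Definition ext_pow (n : nat) : ext_field := FracField.tofrac ('X^n : {poly F}).

Lemma ext_pow_inj : injective ext_pow.
Proof.
move=> m n /eqP; rewrite tofrac_eq => /eqP /(congr1 (fun p : {poly F} => size p)).
by rewrite !size_polyXn => -[].
Qed.

Lemma skeleton_down D m : simplicial_complex D -> down_closed (skeleton D m).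
Proof.
move=> [_ dD] A B; rewrite !inE => /andP[AD Am] sB; rewrite (dD _ _ AD sB).
exact: leq_trans (subset_leq_card sB) Am.
Qed.

Lemma maxsize_skeleton D m : simplicial_complex D -> (m <= maxsize D)%N ->
  maxsize (skeleton D m) = m.
Proof.
move=> [D0 dD] mD; apply/eqP; rewrite eqn_leq; apply/andP; split.
  by apply/bigmax_leqP => A; rewrite inE => /andP[].
have [A0 A0D] := set0Pn _ D0.
have [A AD cA] := maxsize_face (dD _ _ A0D (sub0set _)).
have : (0 < #|[set B : {set V} | B \subset A & #|B| == m]|)%N by rewrite cards_draws bin_gt0 cA.
case/card_gt0P => B; rewrite inE => /andP[sB /eqP cB]; rewrite -{1}cB; apply: maxsize_ge.
by rewrite inE (dD _ _ AD sB) cB /=.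
Qed.

Lemma depth_class D d : simplicial_complex D -> (0 < d)%N -> depth F D = (d%:Z - 1)%R ->
  (d <= maxsize D)%N /\ cm_class ext_field (skeleton D d) d.
Proof.
move=> sD d0 hd; have {hd} ds : depth_size F D = d.
  by move: hd; rewrite /depth => /(addIr _) [].
have [m mD [cm dm]] : exists2 m : 'I_(maxsize D).+1, true & cohen_macaulay F (skeleton D m) /\ d = m.
  have := @eq_bigmax_cond _ (fun m : 'I_(maxsize D).+1 => cohen_macaulay F (skeleton D m)) (@nat_of_ord _).
  case; last by move=> m cm e; exists m => //; split=> //; rewrite -ds.
  rewrite lt0n; apply: contraTneq d0 => /card0_eq c0.
  by rewrite -ds /depth_size big1 // => m cm; have := c0 m; rewrite unfold_in /= cm.
have dm' : (d <= maxsize D)%N by rewrite dm -ltnS.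
split=> //; rewrite -{2}(maxsize_skeleton sD dm').
apply: cm_class_of_links; first exact: skeleton_down.
move=> A k AS kA; apply: rhom_acyclic; apply: (rhom_vanishes_map ext_inj).
move: cm; rewrite -dm => /forall_inP/(_ A AS)/forallP/(_ (Ordinal kA)); exact.
Qed.
End Extension.

(** * Near-cones: bound and uniqueness *)

Section NearCone.
Variables (K : fieldType) (pw : nat -> K) (V : finType) (D : {set {set V}}) (a : V) (d r : nat).
Hypotheses (pw_inj : injective pw) (sD : simplicial_complex D).
Hypothesis skD : cm_class K (skeleton D d) d.
Hypotheses (r0 : 0 < r) (rd : r.*2 < d) (shD : shifted_wrt D a).
Implicit Types (A B : {set V}) (G : {set {set V}}) (v : V).

Let dD : down_closed D. Proof. by case: sD. Qed.
Let d0 : 0 < d. Proof. exact: leq_ltn_trans rd. Qed.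

Let D_set0 : set0 \in D.
Proof. by case: sD => /set0Pn[A AD] h; apply: h AD (sub0set _). Qed.

(* Otherwise the boundary of the cone over B is a cycle of size below d in which B occurs, but no
   face of D containing B and one more vertex exists, by shiftedness. *)
Lemma add_apex B : B \in D -> #|B| < d -> a |: B \in D.
Proof.
move=> BD Bd; have [aB|aB] := boolP (a \in B); first by rewrite (setUidPr _) // sub1set.
apply/negPn/negP => aBD.
have skB : B \in skeleton D d by rewrite inE BD ltnW.
have hB : chains_of (skeleton D d) #|B| (face K B).
  by move=> A; rewrite ffunE; case: (eqVneq A B) => [->|]; rewrite // eqxx.
pose x := bdr (ones K V) (vmul a (face K B)).
have xE : x = (face K B - vmul a (bdr (ones K V) (face K B)))%R.
  by rewrite /x bdr_vmul ffunE scale1r.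
have dS : down_closed (skeleton D d) by apply: skeleton_down.
have hx : chains_of (skeleton D d) #|B| x.
  rewrite xE; apply: chains_ofB => // A /vmul_neq0/andP[aA /bdr_neq0[w wA]].
  rewrite ffunE; case: (eqVneq (w |: A :\ a) B) => [e _|]; last by rewrite eqxx.
  have wB : w \in B by rewrite -e setU11.
  have wa : w != a by apply: contraNneq aB => <-.
  have -> : A = (B :\ w) :|: [set a].
    rewrite -e setUC -[LHS](setD1K aA); congr (_ |: _).
    by rewrite setU1K // .
  split.
    rewrite inE shD // setUC cardsU1 !inE (negPf aB) andbF /= add1n.
    by rewrite (leq_trans _ (ltnW Bd)) // [in X in _ <= X](cardsD1 w B) wB.
  by rewrite setUC cardsU1 !inE (negPf aB) andbF /= [RHS](cardsD1 w B) wB.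
have [y hy xy] := class_acyclic skD Bd hx (bdr_sq _ _).
have : x B != 0%R.
  by rewrite xE !ffunE (negPf aB) subr0 eqxx oner_neq0.
rewrite xy => /bdr_neq0[w wB /hy[]]; rewrite inE => /andP[wBD _] _.
by have := shD wBD (setU11 w B); rewrite setU1K // setUC (negPf aBD).
Qed.

(** The link of [a] in the skeleton, written as a star base to inherit [star_base_class]. By
    [add_apex] it contains every face of size below [d] that avoids [a]. *)
Definition apex_base : {set {set V}} := star_base (skeleton D d) [set a] a.
Local Notation L := apex_base.
Local Notation N := (fnum L r.-1).

Lemma apex_baseE B : (B \in L) = [&& a \notin B, a |: B \in D & #|B| < d].
Proof.
rewrite !inE andbC; case: (boolP (a \in B)) => //= aB.
by rewrite cardsU1 aB.
Qed.

Lemma apex_base_class : cm_class K L d.-1.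
Proof. by apply: star_base_class skD _; rewrite inE. Qed.

Lemma vertex_apex : [set a] \in D.
Proof. by have := add_apex D_set0; rewrite cards0 setU0; apply. Qed.

Lemma apex_base0 : set0 \in L.
Proof. by rewrite apex_baseE inE setU0 vertex_apex cards0. Qed.

Lemma fnum_apex_base : fnum (link D [set a]) r.-1 = N.
Proof.
apply: eq_card => B; rewrite [LHS]inE [RHS]inE link_in // disjoints1 apex_baseE.
case: (eqVneq #|B| r.-1) => [->|]; last by rewrite !andbF.
have -> : r.-1 < d by lia.
by rewrite !andbT.
Qed.

Definition off_part G : {set {set V}} := [set A in G | a \notin A].
Definition on_part G : {set {set V}} := [set B : {set V} | (a \notin B) && (a |: B \in G)].

Lemma card_parts G : #|G| = #|off_part G| + #|on_part G|.
Proof.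
rewrite -(cardsID [set A : {set V} | a \in A] G) addnC; congr (_ + _).
  by apply: eq_card => A; rewrite !inE andbC.
have <- : #|[set a |: B | B in on_part G]| = #|on_part G|.
  apply: card_in_imset => B C; rewrite !inE => /andP[aB _] /andP[aC _] e.
  by rewrite -(setU1K aB) e setU1K.
apply: eq_card => A; rewrite inE [A \in [set _ | _]]inE.
apply/andP/imsetP => [[AG aA]|[B]].
  by exists (A :\ a); rewrite ?inE ?eqxx ?setD1K.
by rewrite inE => /andP[aB h] ->; rewrite h setU11.
Qed.

Section Parts.
Variable G : {set {set V}}.
Hypothesis iG : intersecting_faces D r G.

Lemma off_part_sub : off_part G \subset L.
Proof.
have [/subsetP GD [Gr _]] := iG.
apply/subsetP=> A; rewrite inE => /andP[AG aA]; rewrite apex_baseE aA.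
have h : #|A| < d by rewrite Gr //; lia.
by rewrite add_apex // GD.
Qed.

Lemma on_part_card B : B \in on_part G -> #|B| = r.-1.
Proof. by have [_ [Gr _]] := iG; rewrite inE => /andP[aB /Gr <-]; rewrite cardsU1 aB. Qed.

Lemma on_part_sub : on_part G \subset L.
Proof.
have [/subsetP GD _] := iG.
apply/subsetP=> B hB; have cB := on_part_card hB; move: hB.
by rewrite inE apex_baseE cB => /andP[-> /GD ->] /=; lia.
Qed.

Lemma off_part_card A : A \in off_part G -> #|A| = r.
Proof. by have [_ [Gr _]] := iG; rewrite inE => /andP[/Gr]. Qed.

Lemma off_on_cross A B : A \in off_part G -> B \in on_part G -> A :&: B != set0.
Proof.
have [_ [_ Gi]] := iG; rewrite !inE => /andP[AG aA] /andP[aB BG].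
have /set0Pn[v] := Gi _ _ AG BG; rewrite !inE => /andP[vA /orP[/eqP e|vB]].
  by rewrite -e vA in aA.
by apply/set0Pn; exists v; rewrite inE vA.
Qed.

Lemma off_off_cross A B : A \in off_part G -> B \in off_part G -> A :&: B != set0.
Proof. by have [_ [_ Gi]] := iG; rewrite !inE => /andP[AG _] /andP[BG _]; apply: Gi. Qed.

Lemma near_cone_bound : #|G| <= N.
Proof.
rewrite card_parts; apply: (family_bound pw_inj apex_base_class apex_base0 (p := r) (e := 1)) => //.
- by lia.
- exact: off_part_sub.
- exact: on_part_sub.
- exact: off_part_card.
- exact: on_part_card.
- exact: off_on_cross.
- by move=> _; apply: off_off_cross.
by lia.
Qed.

Lemma near_cone_strict : off_part G != set0 ->
  (forall A v, A \in off_part G -> v \in A -> A :\ v \in on_part G) -> #|G| < N.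
Proof.
move=> G0 hG.
rewrite card_parts; apply: (family_strict pw_inj apex_base_class apex_base0 (p := r) (e := 1)) => //.
- by lia.
- exact: off_part_sub.
- exact: on_part_sub.
- exact: off_part_card.
- exact: on_part_card.
- exact: off_on_cross.
- by move=> _; apply: off_off_cross.
- by lia.
by lia.
Qed.
End Parts.

(** The compression of extremal set theory: a face stays put when its image is already in [G], which
    makes the map injective on [G]. *)
Definition shift1 v G A :=
  if [&& v \in A, a \notin A & a |: (A :\ v) \notin G] then a |: (A :\ v) else A.
Definition shiftG v G : {set {set V}} := [set shift1 v G A | A in G].

Lemma shift1_inj v G : {in G &, injective (shift1 v G)}.
Proof.
move=> A B AG BG; rewrite /shift1.
case: (boolP [&& v \in A, a \notin A & a |: (A :\ v) \notin G]) => hA;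
case: (boolP [&& v \in B, a \notin B & a |: (B :\ v) \notin G]) => hB e.
- case/and3P: hA => vA aA _; case/and3P: hB => vB aB _.
  have nA : a \notin A :\ v by rewrite inE (negPf aA) andbF.
  have nB : a \notin B :\ v by rewrite inE (negPf aB) andbF.
  by rewrite -(setD1K vA) -(setD1K vB) -(setU1K nA) e setU1K.
- by case/and3P: hA => _ _; rewrite e BG.
- by case/and3P: hB => _ _; rewrite -e AG.
by [].
Qed.

Lemma card_shiftG v G : #|shiftG v G| = #|G|.
Proof. exact: card_in_imset (@shift1_inj v G). Qed.

(** If [A] and [B] share only [v], then [B] stayed because [a |: (B :\ v)] is in [G]; [A] meets that
    face outside [a] and [v]. *)
Lemma shift_intersect v G A B : intersecting_faces D r G -> A \in G -> B \in G ->
  v \in A -> a \notin A -> a |: (A :\ v) \notin G -> shift1 v G B = B ->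
  (a |: (A :\ v)) :&: B != set0.
Proof.
move=> [_ [_ Gi]] AG BG vA aA nG sB.
have [aB|aB] := boolP (a \in B); first by apply/set0Pn; exists a; rewrite inE setU11.
have /set0Pn[w] := Gi _ _ AG BG; rewrite inE => /andP[wA wB].
have [wv|wv] := eqVneq w v; last by apply/set0Pn; exists w; rewrite !inE wv wA wB orbT.
have BvG : a |: (B :\ v) \in G.
  apply/negPn/negP => h; move: sB; rewrite /shift1 -wv wB aB wv h /= => /setP/(_ a).
  by rewrite setU11 (negPf aB).
have /set0Pn[u] := Gi _ _ AG BvG; rewrite !inE => /andP[uA /orP[/eqP e|/andP[uv uB]]].
  by rewrite -e uA in aA.
by apply/set0Pn; exists u; rewrite !inE uv uA uB orbT.
Qed.

Lemma shiftG_intersecting v G : intersecting_faces D r G -> intersecting_faces D r (shiftG v G).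
Proof.
move=> iG; have [/subsetP GD [Gr Gi]] := iG.
have cases A : A \in G -> (shift1 v G A = A) \/
    [/\ shift1 v G A = a |: (A :\ v), v \in A, a \notin A & a |: (A :\ v) \notin G].
  by move=> _; rewrite /shift1; case: ifP => [/and3P[]|_]; [right|left].
split; last split.
- apply/subsetP=> _ /imsetP[A AG ->]; case: (cases A AG) => [->|[-> vA _ _]]; first exact: GD.
  by rewrite setUC; apply: shD vA; apply: GD.
- move=> _ /imsetP[A AG ->]; case: (cases A AG) => [->|[-> vA aA _]]; first exact: Gr.
  by rewrite cardsU1 inE (negPf aA) andbF -(Gr A AG) [RHS](cardsD1 v A) vA.
move=> _ _ /imsetP[A AG ->] /imsetP[B BG ->].
case: (cases A AG) => [eA|[eA vA aA nA]]; case: (cases B BG) => [eB|[eB vB aB nB]].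
- by rewrite eA eB; apply: Gi.
- by rewrite eA eB setIC; apply: (shift_intersect iG BG AG vB aB nB eA).
- by rewrite eA eB; apply: (shift_intersect iG AG BG vA aA nA eB).
by rewrite eA eB; apply/set0Pn; exists a; rewrite inE !setU11.
Qed.

Lemma off_part_shiftG v G A : A \in G -> shift1 v G A != A ->
  #|off_part (shiftG v G)| < #|off_part G|.
Proof.
move=> AG; rewrite {1}/shift1; case: ifP => [/and3P[vA aA nG] _|_]; last by rewrite eqxx.
apply: proper_card; apply/properP; split.
  apply/subsetP=> _ /[!inE] /andP[/imsetP[B BG ->]]; rewrite /shift1.
  by case: ifP => [_|_ ->]; rewrite ?setU11 // BG.
exists A; first by rewrite inE AG.
rewrite inE negb_and negbK; apply/orP; left; apply/negP => /imsetP[B BG]; rewrite /shift1.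
case: ifP => [_ e|h e]; first by rewrite e setU11 in aA.
by rewrite -e vA aA nG in h.
Qed.

Definition full_star : {set {set V}} := [set a |: B | B in level L r.-1].

Lemma card_full_star : #|full_star| = N.
Proof.
rewrite card_in_imset // => B C; rewrite !inE => /andP[/andP[_ aB] _] /andP[/andP[_ aC] _] e.
by rewrite -(setU1K aB) e setU1K.
Qed.

Lemma full_star_intersecting : intersecting_faces D r full_star.
Proof.
split; last split.
- by apply/subsetP=> _ /imsetP[B + ->]; rewrite inE apex_baseE => /andP[/and3P[]].
- move=> _ /imsetP[B + ->]; rewrite inE apex_baseE => /andP[/and3P[aB _ _] /eqP cB].
  by rewrite cardsU1 aB cB add1n prednK.
by move=> _ _ /imsetP[B _ ->] /imsetP[C _ ->]; apply/set0Pn; exists a; rewrite inE !setU11.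
Qed.

(* If the shift of G is the full star of the apex, then the faces B avoiding v split into those with
   a |: B in G and those with v |: B in G; these are cross-intersecting, so one class is empty. *)
Lemma star_back v G u A0 : intersecting_faces D r G -> #|G| = N ->
  A0 \in G -> shift1 v G A0 != A0 -> (forall A, A \in shiftG v G -> u \in A) ->
  exists u', forall A, A \in G -> u' \in A.
Proof.
move=> iG cG A0G A0m hu; have [/subsetP GD [Gr Gi]] := iG.
have [ua|ua] := eqVneq u a; last first.
  exists u => A AG; have := hu _ (imset_f (shift1 v G) AG).
  by rewrite /shift1; case: ifP => _ //; rewrite !inE (negPf ua) => /andP[].
rewrite {}ua in hu.
have iS := shiftG_intersecting v iG; have [/subsetP SD [Sr _]] := iS.
have Sfull : shiftG v G = full_star.
  apply/eqP; rewrite eqEcard card_full_star card_shiftG cG leqnn andbT.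
  apply/subsetP=> A AS; have aA := hu A AS.
  apply/imsetP; exists (A :\ a); last by rewrite setD1K.
  have cA : #|A :\ a| = r.-1 by rewrite -(Sr A AS) (cardsD1 a A) aA.
  by rewrite inE apex_baseE setD11 setD1K // SD // cA eqxx /=; lia.
pose Lv := deletion L v.
pose Ba : {set {set V}} := [set B in level Lv r.-1 | a |: B \in G].
pose Bv : {set {set V}} := [set B in level Lv r.-1 | v |: B \in G].
move: (A0m); rewrite {1}/shift1; case: ifP => [/and3P[vA0 aA0 _] _|_]; last by rewrite eqxx.
have va : v != a by apply: contraNneq aA0 => <-.
have LvP B : B \in level Lv r.-1 -> [/\ B \in L, v \notin B, a \notin B & #|B| = r.-1].
  rewrite inE => /andP[]; rewrite inE => /andP[BL vB] /eqP cB; split=> //.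
  by move: BL; rewrite apex_baseE => /and3P[].
have cover : level Lv r.-1 \subset Ba :|: Bv.
  apply/subsetP=> B hB; have [BL vB aB cB] := LvP B hB.
  have : a |: B \in shiftG v G.
    by rewrite Sfull; apply: imset_f; rewrite inE BL cB /=.
  case/imsetP=> A AG; rewrite /shift1; case: ifP => [/and3P[vA aA _] e|_ e].
    have nA : a \notin A :\ v by rewrite inE (negPf aA) andbF.
    have eB : B = A :\ v by rewrite -(setU1K aB) e setU1K.
    by rewrite inE; apply/orP; right; rewrite inE hB eB setD1K.
  by rewrite inE; apply/orP; left; rewrite inE hB e.
have Bv0 : Bv != set0.
  apply/set0Pn; exists (A0 :\ v).
  have cA : #|A0 :\ v| = r.-1 by rewrite -(Gr A0 A0G) (cardsD1 v A0) vA0.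
  have : a |: (A0 :\ v) \in D by rewrite setUC; apply: shD vA0; apply: GD.
  move=> h; rewrite inE setD1K // A0G andbT inE cA eqxx andbT inE setD11 apex_baseE h cA.
  by rewrite inE (negPf aA0) andbF /=; lia.
have Ba0 : Ba = set0.
  apply/eqP/negPn/negP => Ba0.
  have : #|Ba| + #|Bv| < fnum Lv r.-1.
    (* Both classes have faces of [r - 1] vertices, and deleting [v] leaves room [d - 2]: the
       requirement is [2(r - 1) < d - 2]. *)
    apply: (family_strict pw_inj (deletion_class v apex_base_class) _ (p := r.-1) (e := 0)) => //.
    - by rewrite inE apex_base0 inE.
    - by rewrite addn0.
    - by apply/subsetP=> B; rewrite inE => /andP[]; rewrite inE => /andP[].
    - by apply/subsetP=> B; rewrite inE => /andP[]; rewrite inE => /andP[].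
    - by move=> B; rewrite inE => /andP[/LvP[]].
    - by move=> B; rewrite inE => /andP[/LvP[]].
    - move=> A B; rewrite inE => /andP[/LvP[_ vA _ _] aAG]; rewrite inE => /andP[/LvP[_ _ aB _] vBG].
      have /set0Pn[w] := Gi _ _ aAG vBG; rewrite !inE => /andP[/orP[/eqP wa|wA] /orP[/eqP wv|wB]].
      + by rewrite -wv wa eqxx in va.
      + by rewrite -wa wB in aB.
      + by rewrite -wv wA in vA.
      by apply/set0Pn; exists w; rewrite inE wA.
    - by lia.
    by lia.
  rewrite ltnNge => /negP[]; apply: leq_trans (subset_leq_card cover) _.
  by rewrite cardsU leq_subr.
exists v => A AG; apply/negPn/negP => vA.
have sA : shift1 v G A = A by rewrite /shift1 (negPf vA).
have aA : a \in A by rewrite -sA; apply: hu; apply: imset_f.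
have : A :\ a \in Ba.
  have cA : #|A :\ a| = r.-1 by rewrite -(Gr A AG) (cardsD1 a A) aA.
  rewrite inE setD1K // AG andbT inE cA eqxx andbT inE [v \in _]inE (negPf vA) andbF andbT.
  by rewrite apex_baseE setD11 setD1K // GD // cA /=; lia.
by rewrite Ba0 inE.
Qed.

(* A maximum family fixed by all shifts A -> A - v + a must be the star of a: otherwise
   near_cone_strict applies. *)
Lemma maximum_star G : intersecting_faces D r G -> #|G| = N ->
  exists u, forall A, A \in G -> u \in A.
Proof.
have [n] := ubnP #|off_part G|; elim: n G => // n IH G; rewrite ltnS => Gn iG cG.
case: (boolP [exists v, [exists A in G, shift1 v G A != A]]) => [/existsP[v /existsP[A /andP[AG hA]]]|].
  have [||u hu] := IH (shiftG v G) _ (shiftG_intersecting v iG).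
  - by apply: leq_trans Gn; apply: off_part_shiftG AG hA.
  - by rewrite card_shiftG.
  exact: star_back iG cG AG hA hu.
rewrite negb_exists => /forallP fixed; exists a => A AG; apply/negPn/negP => aA.
suff : #|G| < N by rewrite cG ltnn.
apply: near_cone_strict => //; first by apply/set0Pn; exists A; rewrite inE AG.
move=> B v; rewrite inE => /andP[BG aB] vB; rewrite !inE (negPf aB) andbF /=.
have := fixed v; rewrite negb_exists => /forallP/(_ B); rewrite BG /= negbK.
rewrite /shift1 vB aB /=; case: (boolP (_ \in G)) => //= _ /eqP/setP/(_ a).
by rewrite setU11 (negPf aB).
Qed.

End NearCone.

Theorem theorem1p3 (F : fieldType) (V : finType) (D : {set {set V}})
    (a : V) (d r : nat) :
  simplicial_complex D ->
  depth F D = (d%:Z - 1)%R ->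
  (0 < r)%N -> (r.*2 < d)%N ->
  shifted_wrt D a ->
  (* (i) *)
  (forall FA, intersecting_faces D r FA ->
     exists v : V, [set v] \in D /\ (#|FA| <= fnum (link D [set v]) r.-1)%N)
  /\
  (* (ii) *)
  (forall FA, intersecting_faces D r FA ->
     (forall FB, intersecting_faces D r FB -> (#|FB| <= #|FA|)%N) ->
     exists v : V, forall A, A \in FA -> v \in A).
Proof.
move=> sD hd r0 rd shD.
have [_ skD] := depth_class sD (leq_ltn_trans (leq0n _) rd) hd.
have pI := @ext_pow_inj F; split=> FA iFA.
  exists a; split; first exact: (vertex_apex sD skD rd shD).
  by rewrite (fnum_apex_base a sD r0 rd); apply: (near_cone_bound pI sD skD r0 rd shD iFA).
move=> maxFA; apply: (maximum_star pI sD skD r0 rd shD iFA).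
(* The full star of [a] attains the bound, so a maximum family has exactly that size. *)
apply/eqP; rewrite eqn_leq (near_cone_bound pI sD skD r0 rd shD iFA) /=.
by rewrite -(card_full_star D a d r); apply/maxFA/(full_star_intersecting D a d r0).
Qed.
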